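(* Let $d\ge1$ be an integer and $T\ge1$. For all integers $N\ge1$ and all $\Delta t>0$ with $N\Delta t\le T$, the solution $\{\sigma_j\}_{j=0}^N$ of the forward Euler scheme for the Neumann problem for the heat equation on the unit ball of $\mathbb{R}^d$ (single-layer representation, defined in the context) with data $\{g_j\}_{j=0}^N$ satisfies $$\Big(\sum_{j=0}^N\|\sigma_j\|_{L^2(S^{d-1})}^2\Big)^{1/2}\;\le\; e\,d\,2^{d-1}\,\Gamma\!\left(\tfrac d2\right)T^{d/2}\,\Big(\sum_{j=0}^N\|g_j\|_{L^2(S^{d-1})}^2\Big)^{1/2}.$$ That is, the forward Euler scheme for the Neumann problem on the unit ball is unconditionally stable on any finite time interval $[0,T]$, for all $d\ge1$.
   Context: The heat kernel in $\mathbb{R}^d$ is $G(\mathbf{x},t)=(4\pi t)^{-d/2}e^{-|\mathbf{x}|^2/(4t)}$. Let $\Gamma=S^{d-1}$ be the unit sphere with outward unit normal $\bm{\nu}(\mathbf{x})=\mathbf{x}$; for $d=1$, $\Gamma=\{-1,1\}$ with counting measure. The normal derivative of $G$ at the target point is $$\frac{\partial G(\mathbf{x}-\mathbf{y},t)}{\partial\bm{\nu}(\mathbf{x})}=-\frac{(\mathbf{x}-\mathbf{y})\cdot\bm{\nu}(\mathbf{x})}{2^{d+1}\pi^{d/2}t^{1+d/2}}\,e^{-\frac{|\mathbf{x}-\mathbf{y}|^2}{4t}},\qquad \mathbf{x},\mathbf{y}\in\Gamma,\ t>0 .$$ Given $g_0,\dots,g_N\in L^2(\Gamma)$ with $g_0\equiv0$,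 the forward Euler scheme for the integral equation $(\tfrac12+\mathcal{S}_{\bm{\nu}})[\sigma]=g$ (with $\mathcal{S}_{\bm\nu}$ the normal derivative of the single layer heat potential) determines $\sigma_0\equiv0,\sigma_1,\dots,\sigma_N$ by $$\tfrac12\sigma_j(\mathbf{x})+\sum_{k=0}^{j-1}\int_{k\Delta t}^{(k+1)\Delta t}\int_\Gamma\frac{\partial G(\mathbf{x}-\mathbf{y},j\Delta t-\tau)}{\partial\bm{\nu}(\mathbf{x})}\,\sigma_k(\mathbf{y})\,ds(\mathbf{y})\,d\tau=g_j(\mathbf{x}),\qquad j=0,\dots,N.$$ *)

(* Defs.v *)
From HB Require Import structures.
From mathcomp Require Import all_boot all_order all_algebra.
From mathcomp Require Import all_classical all_reals all_analysis.
From mathcomp Require Import measurable_realfun.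
From mathcomp Require Import ring.

Set Implicit Arguments.
Unset Strict Implicit.
Unset Printing Implicit Defensive.

Import Order.TTheory GRing.Theory Num.Theory.
Import numFieldNormedType.Exports.

Local Open Scope classical_set_scope.
Local Open Scope ring_scope.

Definition pushforward_measure d1 d2 (T1 : measurableType d1)
    (T2 : measurableType d2) (R : realType) (m : {measure set T1 -> \bar R})
    (f : T1 -> T2) (mf : measurable_fun setT f) : {measure set T2 -> \bar R} :=
  measure_function_pushforward__canonical__measure_function_Measure m mf.

Lemma pushforward_measureE d1 d2 (T1 : measurableType d1)
    (T2 : measurableType d2) (R : realType) (m : {measure set T1 -> \bar R})
    (f : T1 -> T2) (mf : measurable_fun setT f) :
  pushforward_measure m mf = pushforward m f :> (set T2 -> \bar R).
Proof. by []. Qed.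

(* R^n is n.-tuple R: this type carries the product sigma-algebra (generated
   by the coordinates), and it has no norm that could be confused with the
   Euclidean one (the library norm on 'rV[R]_n is the sup norm). *)
Notation vec R n := (n.-tuple (measurableTypeR R)).

Section euclidean.
Context {R : realType} {n : nat}.
Implicit Types x y : vec R n.

Definition vadd x y : vec R n := [tuple tnth x i + tnth y i | i < n].
Definition vsub x y : vec R n := [tuple tnth x i - tnth y i | i < n].
Definition vscale (a : R) x : vec R n := [tuple a * tnth x i | i < n].
Definition dot x y : R := \sum_(i < n) tnth x i * tnth y i.
Definition enorm x : R := Num.sqrt (dot x x).

Definition sphere : set (vec R n) := [set x | enorm x = 1].
Definition unit_ball : set (vec R n) := [set x | enorm x <= 1].

Definition normalize x : vec R n := vscale (enorm x)^-1 x.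

Lemma measurable_enorm : measurable_fun [set: vec R n] enorm.
Proof.
apply: (@measurableT_comp _ _ _ _ _ _ (Num.sqrt : R -> R)).
  by apply: continuous_measurable_fun; exact: sqrt_continuous.
rewrite /dot; apply: measurable_sum => i.
by apply: measurable_funM; exact: measurable_tnth.
Qed.

Lemma dot_ge0 x : 0 <= dot x x.
Proof. by apply: sumr_ge0 => i _; rewrite -expr2 sqr_ge0. Qed.

Lemma enorm_vscale a x : enorm (vscale a x) = `|a| * enorm x.
Proof.
rewrite /enorm -sqrtr_sqr -sqrtrM ?sqr_ge0//; congr Num.sqrt.
by rewrite /dot mulr_sumr; apply: eq_bigr => i _; rewrite tnth_mktuple; ring.
Qed.

Lemma enorm_eq0 x : enorm x = 0 -> forall i, tnth x i = 0.
Proof.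
move=> /eqP; rewrite sqrtr_eq0 => x0 i.
have /eqP := le_anti (introT andP (conj x0 (dot_ge0 x))).
rewrite psumr_eq0 => [|j _]; last by rewrite -expr2 sqr_ge0.
by move=> /allP/(_ i (mem_index_enum i)); rewrite /= mulf_eq0 orbb => /eqP.
Qed.

Lemma enorm_normalize x : enorm x != 0 -> enorm (normalize x) = 1.
Proof.
by move=> x0; rewrite enorm_vscale ger0_norm ?invr_ge0 ?sqrtr_ge0// mulVf.
Qed.

Lemma measurable_sphere : measurable sphere.
Proof.
rewrite (_ : sphere = enorm @^-1` [set 1]) //.
by rewrite -[X in measurable X]setTI; exact: measurable_enorm.
Qed.

Lemma measurable_unit_ball : measurable unit_ball.
Proof.
rewrite (_ : unit_ball = enorm @^-1` `]-oo, 1]).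
  by rewrite -[X in measurable X]setTI; exact: measurable_enorm.
by apply/seteqP; split => x /=; rewrite in_itv.
Qed.

Lemma measurable_normalize : measurable_fun [set: vec R n] normalize.
Proof.
apply/measurable_fun_tnthP => i.
rewrite (_ : _ \o _ = fun x => enorm x `^ (-1) * tnth x i); last first.
  by apply/funext => x /=; rewrite tnth_mktuple powR_inv1 ?sqrtr_ge0.
apply: measurable_funM; last exact: measurable_tnth.
apply: (@measurableT_comp _ _ _ _ _ _ (powR (R:=R) ^~ (-1))).
  exact: measurable_powR.
exact: measurable_enorm.
Qed.

End euclidean.
Arguments sphere {R n}.
Arguments unit_ball {R n}.

Section lebesgue.
Context {R : realType}.

Definition vcons n (p : measurableTypeR R * vec R n) : vec R n.+1 :=
  [tuple of p.1 :: p.2].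

Lemma measurable_vcons n : measurable_fun setT (@vcons n).
Proof. exact: measurable_cons. Qed.

Definition vuncons n (x : vec R n.+1) : measurableTypeR R * vec R n :=
  (thead x, [tuple of behead x]).

Lemma measurable_vuncons n : measurable_fun setT (@vuncons n).
Proof.
apply/measurable_fun_pairP; split; last exact: measurable_behead.
exact: measurable_tnth.
Qed.

Lemma vunconsK n : cancel (@vuncons n) (@vcons n).
Proof. by move=> x; rewrite [RHS]tuple_eta. Qed.

Lemma vconsK n : cancel (@vcons n) (@vuncons n).
Proof. by case=> a x; congr (_, _); apply/val_inj. Qed.

Section lebesgue_step.
Variables (n : nat) (m : {sigma_finite_measure set (vec R n) -> \bar R}).

Definition lebesgue_step : set (vec R n.+1) -> \bar R :=
  pushforward (@lebesgue_measure R \x m)%E (@vcons n).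

HB.instance Definition _ := Measure.copy lebesgue_step
  (pushforward_measure (@lebesgue_measure R \x m)%E (@measurable_vcons n)).

Let lebesgue_step_sigma_finite : sigma_finite setT lebesgue_step.
Proof.
have /sigma_finiteP[F [FT ndF Foo]] := sigma_finiteT (@lebesgue_measure R).
have /sigma_finiteP[G [GT ndG Goo]] := sigma_finiteT m.
exists (fun k => @vuncons n @^-1` (F k `*` G k)).
  rewrite -preimage_bigcup (_ : \bigcup_k _ = setT) ?preimage_setT//.
  apply/seteqP; split=> // -[x y] _.
  have : setT x by [].
  rewrite FT => -[i _ Fx].
  have : setT y by [].
  rewrite GT => -[j _ Gy].
  exists (maxn i j) => //; split.
  - by move: x Fx; exact/subsetPset/ndF/leq_maxl.
  - by move: y Gy; exact/subsetPset/ndG/leq_maxr.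
move=> k; have [mF Fk] := Foo k; have [mG Gk] := Goo k.
have mFG : measurable (F k `*` G k) by exact: measurableX.
split.
  by rewrite -[X in measurable X]setTI; exact: measurable_vuncons.
rewrite /lebesgue_step /pushforward -comp_preimage.
rewrite (_ : _ \o _ = id); last by apply/funext; exact: vconsK.
by rewrite preimage_id product_measure1E// lte_mul_pinfty// ge0_fin_numE.
Qed.

HB.instance Definition _ := Measure_isSigmaFinite.Build _ _ _ lebesgue_step
  lebesgue_step_sigma_finite.

End lebesgue_step.

Fixpoint lebesgue_vec n : {sigma_finite_measure set (vec R n) -> \bar R} :=
  if n is n'.+1 return {sigma_finite_measure set (vec R n) -> \bar R}
  then lebesgue_step (lebesgue_vec n') else dirac ([tuple] : vec R 0).

End lebesgue.

Section surface_measure.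
Context {R : realType}.

(* Surface measure of S^(n-1), as a measure on R^n carried by the sphere:
   |A| = n * Leb {x | 0 < |x| <= 1 and x / |x| \in A}. For n = 1 this is the
   counting measure of {-1, 1}, see surface_measure1. For all n, the complement
   of the sphere is null, see surface_measure_sphereC. *)
Definition surface_measure n : {measure set (vec R n) -> \bar R} :=
  mscale n%:R%:nng
    (pushforward_measure (mrestr (lebesgue_vec n) measurable_unit_ball)
       measurable_normalize).

Lemma surface_measureE n (A : set (vec R n)) :
  surface_measure n A =
  (n%:R%:E * lebesgue_vec n (normalize @^-1` A `&` unit_ball))%E.
Proof. by []. Qed.

Lemma surface_measure1 (A : set (vec R 1)) : measurable A ->
  surface_measure 1 A =
  (dirac ([tuple 1%R] : vec R 1) A + dirac ([tuple (-1)%R] : vec R 1) A)%E.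
Proof.
move=> mA; rewrite surface_measureE mul1e.
set B := _ `&` _.
have mB : measurable B.
  apply: measurableI; last exact: measurable_unit_ball.
  by have := @measurable_normalize R 1 measurableT _ mA; rewrite setTI.
pose v (x : measurableTypeR R) : vec R 1 := [tuple x].
have mv : measurable_fun setT v by exact: measurable_cons.
have mC : measurable (v @^-1` B).
  by have := mv measurableT _ mB; rewrite setTI.
have -> : lebesgue_vec 1 B = lebesgue_measure (v @^-1` B).
  rewrite /= /lebesgue_step /pushforward /product_measure1.
  transitivity (\int[lebesgue_measure]_x (\1_(v @^-1` B) x : R)%:E)%E; last first.
    by rewrite integral_indic// setIT.
  apply: eq_integral => x _ /=.
  rewrite diracE indicE; congr ((nat_of_bool _)%:R%:E).
  rewrite mem_xsection.
  have e : vcons (x, [tuple]) = v x by exact: val_inj.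
  apply/idP/idP => /set_mem xB; apply/mem_set.
    by have : B (v x) by rewrite -e; exact: xB.
  by have : B (vcons (x, [tuple])) by rewrite e; exact: xB.
have vE (x : R) : enorm (v x) = `|x|.
  by rewrite /enorm /dot big_ord_recl big_ord0 addr0 -expr2 sqrtr_sqr.
have vN (x : R) : normalize (v x) = v (`|x|^-1 * x).
  by apply: eq_from_tnth => i; rewrite tnth_mktuple vE (ord1 i).
pose I1 : set R := `]0, 1]%classic.
pose I2 : set R := `[-1, 0[%classic.
have l1 : @lebesgue_measure R I1 = 1%E.
  by rewrite lebesgue_measure_itv/= lte_fin ltr01 oppr0 adde0.
have l2 : @lebesgue_measure R I2 = 1%E.
  by rewrite lebesgue_measure_itv/= lte_fin ltrN10 -EFinD opprK add0r.
pose D1 := if `[< A (v 1) >] then I1 else set0.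
pose D2 := if `[< A (v (-1)) >] then I2 else set0.
have m1 : measurable (D1 : set (measurableTypeR R)).
  by rewrite /D1; case: ifPn => // _; exact: measurable_itv.
have m2 : measurable (D2 : set (measurableTypeR R)).
  by rewrite /D2; case: ifPn => // _; exact: measurable_itv.
have CD : v @^-1` B `\` [set 0] = D1 `|` D2.
  apply/seteqP; split => x.
    move=> [[/= + +] /eqP]; rewrite /unit_ball /= vE vN.
    case: (ltrgt0P x) => // x0 + x1 _.
      rewrite mulVf ?gt_eqF// => Ax; left.
      by rewrite /D1; case: asboolP => // _; rewrite /I1/= in_itv/= x0.
    rewrite invrN mulNr mulVf ?lt_eqF// => Ax; right.
    by rewrite /D2; case: asboolP => // _; rewrite /I2/= in_itv/= x0 lerNl x1.
  case; rewrite /D1 /D2; case: asboolP => // Ax; rewrite /I1 /I2/= in_itv/=.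
    move=> /andP[x0 x1]; split; last by apply/eqP; rewrite gt_eqF.
    by split; rewrite /unit_ball /= ?vN ?vE gtr0_norm// mulVf// gt_eqF.
  move=> /andP[x1 x0]; split; last by apply/eqP; rewrite lt_eqF.
  split; rewrite /unit_ball /=; last by rewrite vE ltr0_norm// lerNl.
  by rewrite vN ltr0_norm// invrN mulNr mulVf// lt_eqF.
have D12 : D1 `&` D2 = set0.
  rewrite -subset0 => x []; rewrite /D1 /D2.
  case: asboolP => // _; case: asboolP => // _; rewrite /I1 /I2/= !in_itv/=.
  by move=> /andP[x0 _] /andP[_ /(lt_trans x0)]; rewrite ltxx.
rewrite (measureDI _ mC (measurable_set1 0)) CD measureU// [X in (_ + X)%E](_ : _ = 0%E).
  rewrite adde0 !diracE; congr (_ + _)%E.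
    rewrite /D1; case: asboolP => [Ax|nAx].
      by rewrite mem_set//; exact: l1.
    by rewrite memNset// measure0.
  rewrite /D2; case: asboolP => [Ax|nAx].
    by rewrite mem_set//; exact: l2.
  by rewrite memNset// measure0.
apply: (@subset_measure0 _ _ _ (@lebesgue_measure R) _ [set (0 : R)]) => //.
- by apply: measurableI => //; exact: measurable_set1.
- exact: lebesgue_measure_set1.
Qed.

Lemma surface_measure_sphereC n : surface_measure n (~` sphere) = 0%E.
Proof.
case: n => [|n]; first by rewrite surface_measureE mul0e.
rewrite surface_measureE.
have mz : measurable ([set 0] `*` [set: vec R n] : set (measurableTypeR R * _)).
  by apply: measurableX => //; exact: measurable_set1.
suff -> : @lebesgue_vec R n.+1 (normalize @^-1` (~` sphere) `&` unit_ball) = 0%E.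
  by rewrite mule0.
apply: (subset_measure0 (B := @vuncons R n @^-1` ([set 0] `*` setT))).
- apply: measurableI; last exact: measurable_unit_ball.
  have := @measurable_normalize R n.+1 measurableT _ (measurableC measurable_sphere).
  by rewrite setTI.
- by have := @measurable_vuncons R n measurableT _ mz; rewrite setTI.
- move=> x [/= xS _]; split => //=.
  have [x0|/enorm_normalize//] := eqVneq (enorm x) 0.
  exact: enorm_eq0.
rewrite /= /lebesgue_step /pushforward -comp_preimage.
rewrite (_ : _ \o _ = id); last by apply/funext; exact: vconsK.
rewrite preimage_id product_measure1E//.
have z0 : @lebesgue_measure R [set 0] = 0%E by exact: lebesgue_measure_set1.
by rewrite [X in (X * _)%E]z0 mul0e.
Qed.

End surface_measure.

Section heat.
Context {R : realType}.

Definition Gamma (s : R) : R :=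
  \int[lebesgue_measure]_(t in `]0, +oo[) (t `^ (s - 1) * expR (- t)).

Definition heat_kernel d (z : vec R d) (t : R) : R :=
  (4 * pi * t) `^ (- (d%:R / 2)) * expR (- (enorm z ^+ 2 / (4 * t))).

Definition outward_normal d (x : vec R d) : vec R d := x.

(* dG(x - y, t) / dnu(x) *)
Definition heat_kernel_dnu d (x y : vec R d) (t : R) : R :=
  derive1 (fun s : R =>
    heat_kernel (vsub (vadd x (vscale s (outward_normal x))) y) t) 0.

Lemma heat_kernel_dnuE d (x y : vec R d) (t : R) : 0 < t ->
  heat_kernel_dnu x y t =
  - (dot (vsub x y) (outward_normal x) /
     (2 ^+ d.+1 * pi `^ (d%:R / 2) * t `^ (1 + d%:R / 2))) *
  expR (- (enorm (vsub x y) ^+ 2 / (4 * t))).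
Proof.
move=> t0; rewrite /heat_kernel_dnu /heat_kernel /outward_normal.
set a := enorm (vsub x y) ^+ 2; set b := dot (vsub x y) x.
have E (s : R) : enorm (vsub (vadd x (vscale s x)) y) ^+ 2 =
    a + (2 * b) * s + dot x x * s ^+ 2.
  rewrite /a /enorm !sqr_sqrtr ?dot_ge0// /b /dot.
  rewrite mulr_sumr 2!mulr_suml -!big_split/=; apply: eq_bigr => i _.
  by rewrite !tnth_mktuple; ring.
under eq_fun do rewrite E.
set c := (4 * pi * t) `^ _.
pose q := (a%:P + (2 * b) *: 'X + dot x x *: 'X^2)%R : {poly R}.
have qE s : q.[s] = a + (2 * b) * s + dot x x * s ^+ 2.
  by rewrite /q !hornerE; ring.
rewrite (_ : (fun s : R => _) =
    c *: (expR \o (fun s : R => (- (4 * t)^-1) *: q.[s]))); last first.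
  apply/funext => s; rewrite /= /GRing.scale/= -/q qE.
  by congr (c * expR _); field; rewrite gt_eqF.
have dq : is_derive (0 : R) (1 : R) (horner q) (2 * b).
  rewrite [2 * b](_ : _ = (deriv q).[0]); last first.
    by rewrite /q !derivD derivC !derivZ derivX derivXn !hornerE /=; ring.
  exact: is_derive_poly.
have de : is_derive (0 : R) (1 : R)
    (fun s : R => (- (4 * t)^-1) *: q.[s]) ((- (4 * t)^-1) *: (2 * b)).
  exact: (is_deriveZ (- (4 * t)^-1) dq).
have dh := is_deriveZ c (is_derive1_comp (is_derive_expR _) de).
rewrite derive1E (@derive_val _ _ _ _ _ _ _ dh).
have q0 : q.[0] = a by rewrite qE; ring.
rewrite q0 /GRing.scale/=.
rewrite (_ : - (4 * t)^-1 * a = - (a / (4 * t))); last by field; rewrite gt_eqF.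
set ex := expR _.
have -> : c = (2 ^+ d * pi `^ (d%:R / 2) * t `^ (d%:R / 2))^-1.
  rewrite /c powRN !powRM ?mulr_ge0 ?pi_ge0 ?ltW//; congr (_ * _ * _)^-1.
  rewrite (_ : 4 = 2 ^+ 2); last by ring.
  by rewrite -powR_mulrn// -powRrM (_ : 2%:R * _ = d%:R) ?powR_mulrn//; field.
rewrite powRD; last by rewrite gt_eqF ?implybT.
rewrite powRr1 ?ltW// exprS.
have p2 : (2 : R) ^+ d != 0 by rewrite expf_neq0.
have pp : (pi : R) `^ (d%:R / 2) != 0 by rewrite gt_eqF// powR_gt0// pi_gt0.
have tt : t `^ (d%:R / 2) != 0 by rewrite gt_eqF// powR_gt0.
by field; rewrite p2 pp tt gt_eqF.
Qed.

(* The unknowns and the data are functions on R^d, of which only the values on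
   the sphere matter; they stand for their classes modulo a.e. equality, hence
   the scheme is required almost everywhere. *)
Definition forward_euler_solution d (dt : R) (N : nat)
    (g sigma : nat -> vec R d -> R) : Prop :=
  forall j, (j <= N)%N ->
    measurable_fun [set: vec R d] (sigma j) /\
    {ae surface_measure d, forall x, sphere x ->
      2^-1 * sigma j x +
      \sum_(k < j)
        \int[lebesgue_measure]_(tau in `[k%:R * dt, k.+1%:R * dt])
          \int[surface_measure d]_(y in sphere)
            (heat_kernel_dnu x y (j%:R * dt - tau) * sigma k y)
      = g j x}.

Local Open Scope ereal_scope.

(* (\sum_(j <= N) ||f_j||_{L^2(S^(d-1))}^2)^(1/2) *)
Definition l2L2_norm d (N : nat) (f : nat -> vec R d -> R) : \bar R :=
  (\sum_(j < N.+1) 'N[surface_measure d]_2%:E[EFin \o f j] ^+ 2) `^ 2^-1.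

End heat.

(* Main.v *)
From HB Require Import structures.
Require Import Defs.
From mathcomp Require Import all_boot all_order all_algebra.
From mathcomp Require Import all_classical all_reals all_analysis.
From mathcomp Require Import measurable_realfun.
From mathcomp Require Import ring lra.

(** Write P(x,y,t) for minus the normal derivative of the heat kernel on the
    sphere; it is symmetric and nonnegative. The key estimate is
      int_0^T int_S P(x,y,t) dy dt <= 1/2 - 1/C     for x in S,
    with C the constant of the theorem. Integrating the outward heat flux over
    the shell 1 < |y| <= 1+e and substituting y = x + sqrt t z, the time integral
    telescopes, since the integrand is half the derivative of |x + sqrt t z|^2.
    As e -> 0, the left-hand side restricted to t >= dl is at most the Gaussian
    probability that x + sqrt t z leaves the unit ball between the times dl and
    T. This event and the disjoint event of being in the ball at time T both
    require x.z < 0 (or z = 0), which has probability at most 1/2; and the second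
    one has probability at least (4 pi T)^(-d/2) e^(-1) |B| = 1/C.

    Since P is symmetric, the row bound is also a column bound, and Schur's test
    in the space-time index (j, x) gives, with m = 1/C,
      sum_j |sigma_j|^2 <= (2/m) sum_j |g_j|^2 + (1 - 2m) sum_j |sigma_j|^2. *)

Set Implicit Arguments.
Unset Strict Implicit.
Unset Printing Implicit Defensive.

Import Order.TTheory GRing.Theory Num.Theory.
Import numFieldNormedType.Exports.

Local Open Scope classical_set_scope.
Local Open Scope ring_scope.

(** The gap 1/C below 1/2 is what lets the argument close: with row sums bounded only by 1/2, the
    Schur test would leave the coefficient 1 before sum_j |sigma_j|^2 on the right, and nothing
    could be absorbed. With it, 2m sum_j |sigma_j|^2 <= (2/m) sum_j |g_j|^2, so the stability
    constant is 1/m = C. Absorbing also needs finite norms, which hold by induction because the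
    scheme is explicit. The time integral telescopes to at most one crossing because, for fixed z,
    the point x + sqrt t z moves along a ray: |x + sqrt t z|^2 is a convex quadratic in sqrt t equal
    to 1 at t = 0, so once above 1 it keeps increasing. The surface measure is defined by cones, so
    a sphere integral is reached through volume integrals over thin shells. Comparing the kernel at
    y and at y/|y| loses a factor exp(-5e/(4t)), which is uniform only for t >= dl; hence e -> 0 at
    fixed dl, and dl -> 0 only afterwards. The factor e^(-1) in 1/C comes from |x - y|^2 <= 4 <= 4T
    in the ball. *)

(** * Measurability of the vector operations *)

Section vec_measurability.
Context {R : realType} {n : nat} d {T : measurableType d}.
Implicit Types f g : T -> vec R n.

Lemma measurable_fun_vadd f g : measurable_fun setT f -> measurable_fun setT g ->
  measurable_fun setT (fun t => vadd (f t) (g t)).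
Proof.
move=> mf mg; apply/measurable_fun_tnthP => i.
rewrite (_ : _ \o _ = fun t => tnth (f t) i + tnth (g t) i); last first.
  by apply/funext => t /=; rewrite tnth_mktuple.
apply: measurable_funD.
  exact: (measurableT_comp (measurable_tnth i) mf).
exact: (measurableT_comp (measurable_tnth i) mg).
Qed.

Lemma measurable_fun_vsub f g : measurable_fun setT f -> measurable_fun setT g ->
  measurable_fun setT (fun t => vsub (f t) (g t)).
Proof.
move=> mf mg; apply/measurable_fun_tnthP => i.
rewrite (_ : _ \o _ = fun t => tnth (f t) i - tnth (g t) i); last first.
  by apply/funext => t /=; rewrite tnth_mktuple.
apply: measurable_funB.
  exact: (measurableT_comp (measurable_tnth i) mf).
exact: (measurableT_comp (measurable_tnth i) mg).
Qed.

Lemma measurable_fun_vscale (a : T -> R) g :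
  measurable_fun setT a -> measurable_fun setT g ->
  measurable_fun setT (fun t => vscale (a t) (g t)).
Proof.
move=> ma mg; apply/measurable_fun_tnthP => i.
rewrite (_ : _ \o _ = fun t => a t * tnth (g t) i); last first.
  by apply/funext => t /=; rewrite tnth_mktuple.
apply: measurable_funM => //.
exact: (measurableT_comp (measurable_tnth i) mg).
Qed.

Lemma measurable_fun_dot f g : measurable_fun setT f -> measurable_fun setT g ->
  measurable_fun setT (fun t => dot (f t) (g t)).
Proof.
move=> mf mg; rewrite /dot; apply: measurable_sum => i; apply: measurable_funM.
  exact: (measurableT_comp (measurable_tnth i) mf).
exact: (measurableT_comp (measurable_tnth i) mg).
Qed.

End vec_measurability.

(** * Tonelli, affine substitutions and the Gaussian integral in R^n *)

Section lebesgue_affine.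
Context {R : realType}.
Local Open Scope ereal_scope.
Local Notation mu := (@lebesgue_measure R).

Lemma integral_lebesgue_vec0 (f : vec R 0 -> \bar R) :
  measurable_fun setT f -> \int[lebesgue_vec 0]_x f x = f [tuple].
Proof. by move=> mf; rewrite integral_dirac// diracT mul1e. Qed.

Lemma ge0_integral_lebesgue_vecS n (f : vec R n.+1 -> \bar R) :
  measurable_fun setT f -> (forall x, 0 <= f x) ->
  \int[lebesgue_vec n.+1]_x f x =
  \int[mu]_a \int[lebesgue_vec n]_x f (vcons (a, x)).
Proof.
move=> mf f0.
transitivity (\int[pushforward_measure (mu \x lebesgue_vec n) (@measurable_vcons R
  n)]_x f x).
  by apply: eq_measure_integral.
rewrite (ge0_integral_pushforward (@measurable_vcons R n))//.
rewrite preimage_setT fubini_tonelli1//.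
  exact: (measurableT_comp mf (@measurable_vcons R n)).
by move=> x; exact: f0.
Qed.

Lemma measurable_integral_vcons n (f : vec R n.+1 -> \bar R) :
  measurable_fun setT f -> (forall x, 0 <= f x) ->
  measurable_fun setT (fun a => \int[lebesgue_vec n]_x f (vcons (a, x))).
Proof.
move=> mf f0.
apply: (@measurable_fun_fubini_tonelli_F _ _ _ _ _ (lebesgue_vec n) (f \o @vcons R
  n)) => //.
  exact: (measurableT_comp mf (@measurable_vcons R n)).
by move=> x; exact: f0.
Qed.

(** The pushforward of Lebesgue measure under x -> a + b x, scaled by |b|, agrees with Lebesgue
    measure on the intervals ]u, v], hence everywhere by uniqueness. *)
Lemma ge0_integral_affine (a b : R) (f : R -> \bar R) : b != 0%R ->
  measurable_fun setT f -> (forall x, 0 <= f x) ->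
  `|b|%:E * \int[mu]_x f (a + b * x)%R = \int[mu]_x f x.
Proof.
move=> b0 mf f0.
have mA : measurable_fun setT (fun x : measurableTypeR R => (a + b * x)%R :
  measurableTypeR R).
  by apply: measurable_funD => //; exact: measurable_funM.
have nb : (0 <= `|b|)%R by [].
pose m := mscale (NngNum nb) (pushforward_measure mu mA).
transitivity (\int[m]_x f x).
  by rewrite ge0_integral_mscale//= (ge0_integral_pushforward mA).
symmetry; apply: eq_measure_integral => A mAA _.
apply: lebesgue_measure_unique => //= _ [[u v]] _ <-/=.
rewrite /m /mscale/= /pushforward.
rewrite (_ : _ @^-1` _ = [set x : R | u < a + b * x <= v]%R); last first.
  by apply/seteqP; split => x /=; rewrite in_itv.
move: (b0); rewrite neq_lt => /orP[bs|bs].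
  (* For b < 0 the preimage of ]u, v] is closed on the left and open on the right; its length is
     unaffected. *)
  rewrite (_ : [set x : R | u < a + b * x <= v]%R = `[((v - a) / b)%R, ((u - a) /
    b)%R[%classic).
    rewrite !lebesgue_measure_itv/= !lte_fin.
    rewrite ltr_nM2r ?invr_lt0// ltrD2r; case: (u < v)%R; last by rewrite mule0.
    by rewrite -!EFinD -EFinM ltr0_norm//; congr EFin; field.
  apply/seteqP; split => x /=; rewrite in_itv/= ler_ndivrMr// ltr_ndivlMr//;
    by move=> /andP[? ?]; apply/andP; split; lra.
rewrite (_ : [set x : R | u < a + b * x <= v]%R = `]((u - a) / b)%R, ((v - a) /
  b)%R]%classic).
  rewrite !lebesgue_measure_itv/= !lte_fin.
  rewrite ltr_pM2r ?invr_gt0// ltrD2r; case: (u < v)%R; last by rewrite mule0.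
  by rewrite -!EFinD -EFinM gtr0_norm//; congr EFin; field.
apply/seteqP; split => x /=; rewrite in_itv/= ltr_pdivrMr// ler_pdivlMr//;
  by move=> /andP[? ?]; apply/andP; split; lra.
Qed.

Definition vaffine n (a : vec R n) (b : R) (z : vec R n) := vadd a (vscale b z).

Lemma measurable_vaffine n (a : vec R n) b : measurable_fun setT (vaffine a b).
Proof. by apply: measurable_fun_vadd => //; exact: measurable_fun_vscale. Qed.

(** Induction on the dimension: the one-dimensional substitution acts on the head, the induction
    hypothesis on the tail. Translations and dilations are the only substitutions in R^n that the
    proof uses; polar coordinates and rotations never enter. *)
Lemma ge0_integral_vaffine n (a : vec R n) (b : R) (f : vec R n -> \bar R) :
  b != 0%R -> measurable_fun setT f -> (forall x, 0 <= f x) ->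
  (`|b| ^+ n)%:E * \int[lebesgue_vec n]_z f (vaffine a b z) =
  \int[lebesgue_vec n]_x f x.
Proof.
move=> b0; elim: n a f => [|n IH] a f mf f0.
  rewrite mul1e; apply: eq_integral => x _; congr f.
  by apply: eq_from_tnth => -[].
have mfa : measurable_fun setT (fun z => f (vaffine a b z)).
  exact: (measurableT_comp mf (measurable_vaffine a b)).
rewrite !ge0_integral_lebesgue_vecS//.
rewrite -(@ge0_integral_affine (thead a) b
    (fun a0 => \int[lebesgue_vec n]_x f (vcons (a0, x))))//; last 2 first.
- exact: measurable_integral_vcons.
- by move=> x; apply: integral_ge0 => y _; exact: f0.
rewrite exprS EFinM -muleA; congr (_ * _).
rewrite -ge0_integralZl//; last 2 first.
- by apply: (measurable_integral_vcons mfa) => x; exact: f0.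
- by move=> x _; apply: integral_ge0 => y _; exact: f0.
apply: eq_integral => x _.
pose c : measurableTypeR R := (thead a + b * x)%R.
have mfc : measurable_fun setT (fun y => f (vcons (c, y))).
  exact: (measurableT_comp mf
    (measurableT_comp (@measurable_vcons R n) (pair1_measurable c))).
rewrite -(IH [tuple of behead a] _ mfc)//.
congr (_ * _); apply: eq_integral => y _; congr f.
rewrite /vaffine [a in LHS]tuple_eta.
apply: eq_from_tnth => i; rewrite !tnth_mktuple.
case: (unliftP ord0 i) => [j ->|->]; last by rewrite !tnth0.
by rewrite !tnthS !tnth_mktuple.
Qed.

Lemma integral_vec_gauss n :
  \int[lebesgue_vec n]_x (expR (- dot x x))%:E = (Num.sqrt pi ^+ n)%:E :> \bar R.
Proof.
have md m : measurable_fun setT (fun x : vec R m => (expR (- dot x x))%:E).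
  apply/measurable_EFinP; apply: measurableT_comp => //.
  by apply: measurableT_comp => //; exact: measurable_fun_dot.
elim: n => [|n IH].
  by rewrite integral_lebesgue_vec0// /dot big_ord0 oppr0 expR0.
rewrite ge0_integral_lebesgue_vecS//.
have E a x : expR (- dot (vcons (a, x)) (vcons (a, x))) =
    (expR (- a ^+ 2) * expR (- @dot R n x x))%R.
  rewrite -expRD; congr expR; rewrite /dot big_ord_recl !tnth0 opprD expr2.
  by congr (_ + - _)%R; apply: eq_bigr => i _; rewrite !tnthS.
transitivity (\int[mu]_a ((expR (- a ^+ 2))%:E * (Num.sqrt pi ^+ n)%:E)).
  apply: eq_integral => a _; rewrite -IH -ge0_integralZl_EFin ?expR_ge0//.
  - by apply: eq_integral => x _; rewrite E.
  - exact: md.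
under eq_integral => a _ do rewrite muleC.
rewrite ge0_integralZl_EFin ?exprn_ge0 ?sqrtr_ge0//.
- by rewrite integralT_gauss -EFinM exprSr.
- by apply/measurable_EFinP; exact: measurable_gauss_fun.
Qed.

End lebesgue_affine.

(** * The fundamental theorem of calculus and integrals up to a singular endpoint *)

Section calculus.
Context {R : realType}.
Local Open Scope ereal_scope.
Local Notation mu := (@lebesgue_measure R).

Lemma integral_is_derive (F f : R -> R) (a b : R) : (a < b)%R ->
  (forall x, (a <= x <= b)%R -> is_derive x 1%R F (f x)) ->
  (forall x, (a <= x <= b)%R -> {for x, continuous f}) ->
  \int[mu]_(x in `[a, b]) (f x)%:E = (F b - F a)%:E.
Proof.
move=> ab dF cf; rewrite EFinB.
have cF x : (a <= x <= b)%R -> {for x, continuous F}.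
  move=> xab; apply: differentiable_continuous; apply/derivable1_diffP.
  by have [] := dF x xab.
apply: continuous_FTC2 => //.
- apply: continuous_in_subspaceT => x; rewrite inE/= in_itv/= => xab.
  exact: cf.
- split.
  + move=> x; rewrite in_itv/= => /andP[ax xb].
    by have [] := dF x; rewrite ?ltW.
  + by apply: cvg_at_right_filter; apply: cF; rewrite lexx ltW.
  + by apply: cvg_at_left_filter; apply: cF; rewrite lexx ltW.
- move=> x; rewrite in_itv/= => /andP[ax xb]; rewrite derive1E.
  by have [] := dF x; rewrite ?ltW.
Qed.

(** The denominators start at 2, so that u / [n.+2%:R] < u for every n and no interval degenerates,
    as [integral_is_derive] requires. *)
Lemma itv_oc_bigcup (u : R) : (0 < u)%R ->
  `]0%R, u]%classic = \bigcup_n `[(u / n.+2%:R)%R, u]%classic.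
Proof.
move=> u0; apply/seteqP; split => x /=; rewrite ?in_itv/=.
  move=> /andP[x0 xu]; exists (Num.truncn (u / x)) => //=.
  rewrite in_itv/= xu andbT ler_pdivrMr ?ltr0n// -ler_pdivrMl//.
  rewrite mulrC; apply: le_trans (ltW (truncnS_gt _)) _; by rewrite ler_nat.
case=> n _; rewrite /= !in_itv/= => /andP[xn ->].
by rewrite (lt_le_trans _ xn)// divr_gt0.
Qed.

Lemma cvg_integral_itv_oc (f : R -> \bar R) (u : R) : (0 < u)%R ->
  (forall D : set (measurableTypeR R), measurable_fun D f) -> (forall t, 0 <= f t) ->
  \int[mu]_(t in `[(u / n.+2%:R)%R, u]) f t @[n --> \oo] -->
  \int[mu]_(t in `]0%R, u]) f t.
Proof.
move=> u0 mf f0; rewrite itv_oc_bigcup//.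
apply: ge0_nondecreasing_set_cvg_integral => //.
- move=> m n mn; apply/subsetPset => x; rewrite /= !in_itv/= => /andP[mx ->].
  rewrite andbT (le_trans _ mx)// ler_pM2l// lef_pV2 ?posrE ?ltr0n//.
  by rewrite ler_nat !ltnS.
Qed.

(** For p < 1 (that is, n = 1 when p = n/2) the integrand is singular at 0, so the fundamental
    theorem is applied on [u/(n+2), u] and the lower endpoint sent to 0. *)
Lemma integral_powRB1 (p u : R) : (0 < p)%R -> (0 < u)%R ->
  \int[mu]_(r in `]0%R, u]) (p * r `^ (p - 1))%:E = (u `^ p)%:E.
Proof.
move=> p0 u0.
pose F n := `[(u / n.+2%:R)%R, u]%classic.
have FE : `]0%R, u]%classic = \bigcup_n F n := itv_oc_bigcup u0.
have mf D : measurable_fun D (fun r : R => (p * r `^ (p - 1))%:E).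
  apply: measurable_funTS; apply/measurable_EFinP; apply: measurable_funM => //.
have un n : (u / n.+2%:R < u)%R.
  by rewrite ltr_pdivrMr ?ltr0n// ltr_pMr// ltr1n.
have Fn n : \int[mu]_(r in F n) (p * r `^ (p - 1))%:E = (u `^ p - (u / n.+2%:R) `^
  p)%:E.
  have pos x : (u / n.+2%:R <= x <= u)%R -> (0 < x)%R.
    by move=> /andP[xn _]; rewrite (lt_le_trans _ xn)// divr_gt0.
  apply: (@integral_is_derive (fun r => r `^ p)%R) => //.
    by move=> x /pos x0; exact: is_derive1_powR.
  move=> x /pos x0; apply: (@continuousM _ _ (fun=> p)); first exact: cst_continuous.
  apply: differentiable_continuous; apply/derivable1_diffP.
  by apply: derivable_powR; rewrite in_itv/= x0.
have cvF : \int[mu]_(r in F n) (p * r `^ (p - 1))%:E @[n --> \oo] -->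
    \int[mu]_(r in `]0%R, u]) (p * r `^ (p - 1))%:E.
  apply: cvg_integral_itv_oc => // r.
  by rewrite lee_fin mulr_ge0 ?powR_ge0// ltW.
apply: (cvg_unique _ cvF) => //.
rewrite (_ : (fun n => _) = (fun n => (u `^ p - (u / n.+2%:R) `^ p)%:E)); last first.
  by apply/funext => n; exact: Fn.
apply: cvg_EFin; first exact: nearW.
rewrite -[X in _ --> X]subr0; apply: cvgB; first exact: cvg_cst.
apply: (@cvg_comp _ _ _ (fun n : nat => u / n.+2%:R)%R (fun a => a `^ p)%R _
  (0%R^'+)); last first.
  exact: powR_cvg0.
have c0 : ((u / n.+2%:R)%R @[n --> \oo] --> 0%R).
  rewrite -[X in _ --> X](mulr0 u); apply: cvgM; first exact: cvg_cst.
  have := @cvg_harmonic R; rewrite -cvg_shiftS; exact.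
move=> A [e /= e0 eA]; have := c0 _ (nbhsx_ballx 0%R e e0).
move=> [n _ nA]; exists n => // m /nA /= mA; apply: eA => //=.
by rewrite divr_gt0.
Qed.


End calculus.

(** * The volume of the unit ball from the Gaussian integral *)

Section ball_volume.
Context {R : realType}.
Local Open Scope ereal_scope.
Local Notation mu := (@lebesgue_measure R).
Local Notation vol n := (@lebesgue_vec R n).

Lemma enorm_ge0 n (x : vec R n) : (0 <= enorm x)%R.
Proof. exact: sqrtr_ge0. Qed.

Lemma enorm_sqr n (x : vec R n) : (enorm x ^+ 2 = dot x x)%R.
Proof. by rewrite sqr_sqrtr// dot_ge0. Qed.

Lemma dot_vaffine n (a z : vec R n) (b : R) :
  dot (vaffine a b z) (vaffine a b z) =
  (dot a a + 2 * b * dot a z + b ^+ 2 * dot z z)%R.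
Proof.
rewrite /dot !mulr_sumr -!big_split/=; apply: eq_bigr => i _.
by rewrite !tnth_mktuple; ring.
Qed.

Lemma enorm_le n (x : vec R n) (r : R) : (0 <= r)%R ->
  (enorm x <= r)%R = (dot x x <= r ^+ 2)%R.
Proof. by move=> r0; rewrite -enorm_sqr ler_pXn2r ?nnegrE ?enorm_ge0. Qed.

Lemma unit_ballE n (x : vec R n) : unit_ball x = (dot x x <= 1)%R :> Prop.
Proof. by rewrite /unit_ball/= enorm_le// expr1n. Qed.

Lemma measurable_dot_le n (u : R) : measurable [set x : vec R n | (dot x x <= u)%R].
Proof.
rewrite (_ : [set x | _] = (fun x => dot x x) @^-1` `]-oo, u]%classic).
  by rewrite -[X in measurable X]setTI; apply: measurable_fun_dot => //; exact:
    measurable_id.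
by apply/seteqP; split => x /=; rewrite in_itv.
Qed.

Lemma integral_indicT d (T : measurableType d) (m : {measure set T -> \bar R})
    (A : set T) : measurable A -> \int[m]_x (\1_A x)%:E = m A.
Proof. by move=> mA; rewrite integral_indic// setIT. Qed.

Lemma volume_dot_le n (u : R) : (0 < u)%R ->
  vol n [set x | (dot x x <= u)%R] = (u `^ (n%:R / 2))%:E * vol n unit_ball.
Proof.
move=> u0; have su : (0 < Num.sqrt u)%R by rewrite sqrtr_gt0.
rewrite -integral_indicT; last exact: measurable_dot_le.
pose z : vec R n := [tuple 0%R | i < n].
have z0 x : dot z x = 0%R.
  by rewrite /dot big1// => i _; rewrite tnth_mktuple mul0r.
have mA : measurable_fun setT (fun x : vec R n =>
    (\1_[set x : vec R n | (dot x x <= u)%R] x : R)%:E).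
  by apply/measurable_EFinP; apply: measurable_indic; exact: measurable_dot_le.
rewrite -(@ge0_integral_vaffine _ _ z (Num.sqrt u) _ _ mA) ?gt_eqF//.
rewrite gtr0_norm// -powR_mulrn ?sqrtr_ge0// -powR12_sqrt ?ltW// -powRrM mulrC.
congr (_ * _); rewrite -integral_indicT; last exact: measurable_unit_ball.
apply: eq_integral => x _; rewrite !indicE; congr ((nat_of_bool _)%:R%:E).
apply/idP/idP; rewrite !inE unit_ballE/= dot_vaffine !z0;
  by rewrite -powR_mulrn ?powR_ge0// -powRrM mulVf// powRr1 ?(ltW u0)// mulr0
    !add0r -ler_pdivlMl// mulVf ?gt_eqF.
Qed.

Lemma measurable_ler_indic d (T : measurableType d) (f g : T -> R) :
  measurable_fun setT f -> measurable_fun setT g ->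
  measurable_fun setT (fun x => (f x <= g x)%R%:R : R).
Proof.
move=> mf mg; rewrite (_ : (fun _ => _) = \1_[set x | (f x <= g x)%R]); last first.
  by apply/funext => x; rewrite indicE; congr (nat_of_bool _)%:R; apply/idP/idP;
    rewrite inE.
apply: measurable_indic.
have := @measurable_fun_ler _ _ _ _ _ _ mf mg measurableT [set true].
by rewrite setTI; apply.
Qed.

Lemma measurable_ltr_indic d (T : measurableType d) (f g : T -> R) :
  measurable_fun setT f -> measurable_fun setT g ->
  measurable_fun setT (fun x => (f x < g x)%R%:R : R).
Proof.
move=> mf mg; rewrite (_ : (fun _ => _) = \1_[set x | (f x < g x)%R]); last first.
  by apply/funext => x; rewrite indicE; congr (nat_of_bool _)%:R; apply/idP/idP;
    rewrite inE.
apply: measurable_indic.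
have := @measurable_fun_ltr _ _ _ _ _ _ mf mg measurableT [set true].
by rewrite setTI; apply.
Qed.

(** A domain of integration that depends on another variable has to become a factor of the integrand
    before Tonelli can exchange the integrals. *)
Lemma integral_pred d (T : measurableType d) (m : {measure set T -> \bar R})
    (D : set T) (b : T -> bool) (f : T -> R) :
  (forall x, D x <-> b x) ->
  \int[m]_(x in D) (f x)%:E = \int[m]_x ((b x)%:R * f x)%:E.
Proof.
move=> Db; rewrite integral_mkcond; apply: eq_integral => x _.
rewrite patchE; case: ifPn => [|]; first by rewrite inE => /Db ->; rewrite mul1r.
by rewrite notin_setE => nD; case: (boolP (b x)) => [/Db//|_]; rewrite mul0r.
Qed.

Lemma integral_expRN_ge (a : R) :
  \int[mu]_u ((a <= u)%R%:R * expR (- u))%:E = (expR (- a))%:E.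
Proof.
transitivity (\int[mu]_(u in `[a, +oo[) (expR (- u))%:E).
  rewrite [RHS](@integral_pred _ _ _ _ (fun u : measurableTypeR R => a <= u)%R)// => x.
  by rewrite /= in_itv/= andbT.
rewrite (@ge0_continuous_FTC2y _ _ (fun x => - expR (- x))%R _ 0%R).
- by rewrite sub0e EFinN oppeK.
- by move=> x _; exact: expR_ge0.
- apply: continuous_subspaceT => x.
  by apply: (@continuous_comp _ _ _ -%R expR);
    [exact: opp_continuous|exact: continuous_expR].
- by rewrite -oppr0; apply: cvgN; exact: cvgr_expR.
- by move=> x _; apply: derivableN; exact: ex_derive.
- apply: cvg_at_right_filter; apply: cvgN.
  by apply: (@continuous_comp _ _ _ -%R expR);
    [exact: opp_continuous|exact: continuous_expR].
- move=> x _; rewrite derive1E deriveN; last exact: ex_derive.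
  by rewrite derive_val/= mulrN1 opprK.
Qed.

(** Two layer-cake formulas. Writing exp(-|y|^2) as the integral of exp(-u) over u >= |y|^2 gives
    pi^(n/2) = |B| times the integral of u^p exp(-u), where p = n/2. Writing u^p as the integral of
    p r^(p-1) over 0 < r <= u then produces p Gamma(p) directly, without the functional equation of
    Gamma. *)
Lemma volume_unit_ball n : (0 < n)%N ->
  vol n unit_ball *
    \int[mu]_(r in `]0%R, +oo[) ((n%:R / 2) * r `^ (n%:R / 2 - 1) * expR (- r))%:E
  = (pi `^ (n%:R / 2))%:E.
Proof.
move=> n0; set p : R := (n%:R / 2)%R.
have p0 : (0 < p)%R by rewrite divr_gt0// ltr0n.
pose f1 (z : vec R n * measurableTypeR R) := ((dot z.1 z.1 <= z.2)%R%:R * expR (-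
  z.2))%R.
have mf1 : measurable_fun setT (EFin \o f1).
  apply/measurable_EFinP; apply: measurable_funM; last first.
    by apply: measurableT_comp => //; apply: measurableT_comp => //; exact:
      measurable_snd.
  apply: measurable_ler_indic; last exact: measurable_snd.
  by apply: measurable_fun_dot; exact: measurable_fst.
have f10 z : 0 <= (EFin \o f1) z by rewrite lee_fin mulr_ge0 ?expR_ge0.
pose f2 (z : measurableTypeR R * measurableTypeR R) := ((0 < z.1)%R%:R * (z.1 <=
  z.2)%R%:R * (p * z.1 `^ (p - 1)) *
  expR (- z.2))%R.
have mf2 : measurable_fun setT (EFin \o f2).
  apply/measurable_EFinP; apply: measurable_funM; last first.
    by apply: measurableT_comp => //; apply: measurableT_comp => //; exact:
      measurable_snd.
  apply: measurable_funM.
    apply: measurable_funM.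
      by apply: measurable_ltr_indic => //; exact: measurable_fst.
    by apply: measurable_ler_indic; [exact: measurable_fst|exact: measurable_snd].
  apply: measurable_funM => //.
  apply: (@measurableT_comp _ _ _ _ _ _ (powR (R:=R) ^~ (p - 1)%R));
    [exact: measurable_powR|exact: measurable_fst].
have f20 z : 0 <= (EFin \o f2) z.
  by rewrite lee_fin !mulr_ge0 ?expR_ge0 ?powR_ge0// ltW.
have -> : (pi `^ p)%:E = \int[vol n]_y \int[mu]_u (EFin \o f1) (y, u).
  transitivity (\int[vol n]_y (expR (- dot y y))%:E).
    by rewrite integral_vec_gauss -powR_mulrn ?sqrtr_ge0// -powR12_sqrt ?pi_ge0//
      -powRrM mulrC.
  by apply: eq_integral => y _; rewrite -integral_expRN_ge.
rewrite (fubini_tonelli (EFin \o f1))//.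
transitivity (vol n unit_ball * \int[mu]_r \int[mu]_u (EFin \o f2) (r, u)).
  congr (_ * _); rewrite [LHS](@integral_pred _ _ _ _ (fun r : measurableTypeR R =>
    0 < r)%R); last first.
    by move=> r; rewrite /= in_itv/= andbT.
  apply: eq_integral => r _; rewrite mulrA EFinM -integral_expRN_ge.
  rewrite -ge0_integralZl_EFin//.
  - by apply: eq_integral => u _; rewrite -EFinM/= /f2/=; congr EFin; ring.
  - apply/measurable_EFinP; apply: measurable_funM; first exact: measurable_ler_indic.
    by apply: measurableT_comp.
  - by rewrite !mulr_ge0 ?powR_ge0// ltW.
rewrite (fubini_tonelli (EFin \o f2))//.
rewrite -ge0_integralZl//; last 2 first.
- exact: (measurable_fun_fubini_tonelli_G (EFin \o f2)).
- by move=> u _; apply: integral_ge0.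
rewrite [RHS](_ : _ = \int[mu]_(u in `[0%R, +oo[) \int[vol n]_y (EFin \o f1) (y,
  u)); last first.
  rewrite [RHS]integral_mkcond; apply: eq_integral => u _; rewrite patchE.
  case: ifPn => // /negP; rewrite inE/= in_itv/= andbT => /negP; rewrite -ltNge => u0.
  apply: integral0_eq => y _; rewrite /= /f1/= leNgt (lt_le_trans u0) ?dot_ge0//.
  by rewrite mul0r.
rewrite [LHS](_ : _ = \int[mu]_(u in `[0%R, +oo[)
    (vol n unit_ball * \int[mu]_r (EFin \o f2) (r, u))); last first.
  rewrite [RHS]integral_mkcond; apply: eq_integral => u _; rewrite patchE.
  case: ifPn => // /negP; rewrite inE/= in_itv/= andbT => /negP; rewrite -ltNge => u0.
  rewrite integral0_eq ?mule0// => r _; rewrite /= /f2/=.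
  case: ltP => r0; rewrite ?mul0r// leNgt (lt_trans u0 r0).
  by rewrite mulr0 !mul0r.
(* The point u = 0 is dropped because the dilation in [volume_dot_le] needs u > 0. *)
rewrite -(integral_itv_obnd_cbnd (b := BInfty _ false)); last first.
  apply: measurable_funTS; apply: measurable_funeM.
  exact: (measurable_fun_fubini_tonelli_G (EFin \o f2)).
rewrite -(integral_itv_obnd_cbnd (b := BInfty _ false)); last first.
  apply: measurable_funTS.
  exact: (measurable_fun_fubini_tonelli_G (EFin \o f1)).
apply: eq_integral => u; rewrite inE/= in_itv/= andbT => u0.
transitivity (vol n unit_ball * ((expR (- u))%:E * (u `^ p)%:E)).
  congr (_ * _); rewrite -integral_powRB1//.
  rewrite -ge0_integralZl_EFin ?expR_ge0//; last 2 first.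
  - by move=> r _; rewrite lee_fin mulr_ge0 ?powR_ge0 ?(ltW p0).
  - by apply: measurable_funTS; apply/measurable_EFinP; apply: measurable_funM => //.
  rewrite [RHS]integral_mkcond; apply: eq_integral => r _.
  rewrite patchE mem_setE in_itv/= /f2/=.
  by case: ltP => r0; case: leP => ru; rewrite ?mul0r ?mulr0 ?mul0r// !mul1r -EFinM
    mulrC.
transitivity ((expR (- u))%:E * vol n [set y | (dot y y <= u)%R]).
  by rewrite volume_dot_le// -/p muleCA [X in _ = _ * X]muleC.
rewrite -integral_indicT; last exact: measurable_dot_le.
rewrite -ge0_integralZl_EFin ?expR_ge0//; last first.
  by apply/measurable_EFinP; apply: measurable_indic; exact: measurable_dot_le.
apply: eq_integral => y _; rewrite -EFinM /= /f1/= mulrC indicE.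
by congr ((nat_of_bool _)%:R * _)%:E; apply/idP/idP; rewrite inE.
Qed.



End ball_volume.

(** * Finiteness of the surface measure and integrals over the sphere *)

Section surface.
Context {R : realType}.
Local Open Scope ereal_scope.
Local Notation mu := (@lebesgue_measure R).
Local Notation vol n := (@lebesgue_vec R n).

(** Since c > 0, neither factor vanishes, so the convention 0 * +oo = 0 cannot hide an infinite
    factor. *)
Lemma fin_num_factors (a b : \bar R) (c : R) : (0 < c)%R -> 0 <= a -> 0 <= b ->
  a * b = c%:E -> a \is a fin_num /\ b \is a fin_num.
Proof.
move=> c0; case: a => [a||]//; case: b => [b||]//; rewrite ?lee_fin => a0 b0.
- move: a0; rewrite le_eqVlt => /predU1P[<-|a0].
    by rewrite mul0e => -[c00]; rewrite -c00 ltxx in c0.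
  by rewrite gt0_muley ?lte_fin.
- move: b0; rewrite le_eqVlt => /predU1P[<-|b0].
    by rewrite mule0 => -[c00]; rewrite -c00 ltxx in c0.
  by rewrite gt0_mulye ?lte_fin.
Qed.

(** Finiteness of |B| and of the Gamma integral are both read off their finite positive product. The
    latter is needed because [Gamma] is a real-valued integral, which would be 0 by default if the
    integral were infinite. *)
Lemma volume_unit_ball_Gamma n : (0 < n)%N ->
  (0 < @Gamma R (n%:R / 2))%R /\
  vol n unit_ball = (pi `^ (n%:R / 2) / (n%:R / 2 * Gamma (n%:R / 2)))%:E.
Proof.
move=> n0; have := @volume_unit_ball R n n0; set p : R := (n%:R / 2)%R.
have p0 : (0 < p)%R by rewrite divr_gt0// ltr0n.
have pip : (0 < pi `^ p :> R)%R by rewrite powR_gt0// pi_gt0.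
have mg (D : set (measurableTypeR R)) : measurable_fun D (fun r : R => r `^ (p - 1)
  * expR (- r))%R.
  apply: measurable_funTS; apply: measurable_funM => //.
  by apply: measurableT_comp.
set I := \int[mu]_(r in `]0%R, +oo[) (p * r `^ (p - 1) * expR (- r))%:E => volI.
have IE : I = p%:E * \int[mu]_(r in `]0%R, +oo[) (r `^ (p - 1) * expR (- r))%:E.
  rewrite -ge0_integralZl_EFin ?(ltW p0)//.
  - by apply: eq_integral => r _; rewrite -EFinM mulrA.
  - by move=> r _; rewrite lee_fin mulr_ge0 ?powR_ge0 ?expR_ge0.
  - exact/measurable_EFinP.
have I0 : 0 <= I.
  by apply: integral_ge0 => r _; rewrite lee_fin !mulr_ge0 ?powR_ge0 ?expR_ge0// ltW.
have [volf If] := fin_num_factors pip (measure_ge0 _ _) I0 volI.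
have J0 : 0 <= \int[mu]_(r in `]0%R, +oo[) (r `^ (p - 1) * expR (- r))%:E.
  by apply: integral_ge0 => r _; rewrite lee_fin mulr_ge0 ?powR_ge0 ?expR_ge0.
have GE : \int[mu]_(r in `]0%R, +oo[) (r `^ (p - 1) * expR (- r))%:E = (Gamma p)%:E.
  rewrite /Gamma/Rintegral fineK// ge0_fin_numE//.
  move: If; rewrite IE; case: (integral _ _ _) J0 => [r||]//= _.
    by rewrite ltry.
  by rewrite gt0_muley ?lte_fin.
move: volI; rewrite IE GE -(fineK volf) -!EFinM => -[volI].
have G0 : (0 <= @Gamma R p)%R by rewrite -lee_fin -GE.
have Gp : (0 < @Gamma R p)%R.
  rewrite lt_neqAle G0 andbT; apply/negP => /eqP GG.
  by move: pip; rewrite -volI -GG !mulr0 ltxx.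
split=> //; congr EFin; rewrite -volI; field.
by rewrite !gt_eqF ?ltr0n.
Qed.

Lemma volume_unit_ball_lty n : vol n unit_ball < +oo.
Proof.
case: n => [|n]; last by rewrite (volume_unit_ball_Gamma _).2// ltry.
by rewrite /= diracE; case: (_ \in _); rewrite ltry.
Qed.

Lemma ge0_integral_mrestr d (T : measurableType d)
    (m : {measure set T -> \bar R}) (D : set T) (mD : measurable D)
    (f : T -> \bar R) : measurable_fun setT f -> (forall x, 0 <= f x) ->
  \int[mrestr m mD]_x f x = \int[m]_(x in D) f x.
Proof.
move=> mf f0; rewrite [LHS](@ge0_negligible_integral _ _ _ _ _ (~` D))//.
- rewrite setTD setCK; apply: eq_measure_integral => A mA AD.
  by rewrite /= /mrestr setIidl.
- exact: measurableC.
- by rewrite /= /mrestr setICl measure0.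
Qed.

(** A copy of [surface_measure] to which a finite-measure structure can be attached; Tonelli over
    the sphere needs it. *)
Definition surface n : set (vec R n) -> \bar R := surface_measure n.

HB.instance Definition _ n := Measure.copy (@surface n) (surface_measure n).

Let surface_fin n : fin_num_fun (@surface n).
Proof.
apply: lty_fin_num_fun => /=.
rewrite /surface surface_measureE preimage_setT setTI lte_mul_pinfty//.
exact: volume_unit_ball_lty.
Qed.

HB.instance Definition _ n := Measure_isFinite.Build _ _ _ (@surface n)
  (@surface_fin n).

Lemma integral_surface_measureE n D (f : vec R n -> \bar R) :
  \int[surface_measure n]_(x in D) f x = \int[@surface n]_(x in D) f x.
Proof. exact: eq_measure_integral. Qed.

Lemma ge0_integral_surface n (f : vec R n -> \bar R) :
  measurable_fun setT f -> (forall x, 0 <= f x) ->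
  \int[@surface n]_x f x =
  n%:R%:E * \int[vol n]_(x in unit_ball) f (normalize x).
Proof.
move=> mf f0; rewrite -integral_surface_measureE /surface_measure.
rewrite ge0_integral_mscale//; congr (_ * _).
rewrite (ge0_integral_pushforward (@measurable_normalize R n))// preimage_setT.
rewrite ge0_integral_mrestr//; last by move=> x; exact: f0.
exact: (measurableT_comp mf (@measurable_normalize R n)).
Qed.

Lemma ge0_integral_sphere n (f : vec R n -> \bar R) :
  measurable_fun setT f -> (forall x, 0 <= f x) ->
  \int[@surface n]_(x in sphere) f x = \int[@surface n]_x f x.
Proof.
move=> mf f0; rewrite [RHS](@ge0_negligible_integral _ _ _ _ _ (~` sphere))//.
- by rewrite setTD setCK.
- by apply: measurableC; exact: measurable_sphere.
- exact: surface_measure_sphereC.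
Qed.

End surface.

(** * Sphere integrals bounded by integrals over thin shells *)

Section cone.
Context {R : realType}.
Local Open Scope ereal_scope.
Local Notation vol n := (@lebesgue_vec R n).

Definition shell n (e : R) : set (vec R n) :=
  [set y | (1 < dot y y <= (1 + e) ^+ 2)%R].

Lemma measurable_shell n e : measurable (@shell n e).
Proof.
rewrite (_ : shell e = [set y | (dot y y <= (1 + e) ^+ 2)%R] `\` [set y | (dot y y
  <= 1)%R]).
  by apply: measurableD; exact: measurable_dot_le.
apply/seteqP; split => y /=; rewrite /shell/=.
  by move=> /andP[y1 y2]; split => //; apply/negP; rewrite -ltNge.
by move=> [-> /negP]; rewrite -ltNge => ->.
Qed.

Lemma normalize_vscale n (b : R) (y : vec R n) : (0 < b)%R ->
  normalize (vscale b y) = normalize y.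
Proof.
move=> b0; rewrite /normalize enorm_vscale gtr0_norm//.
apply: eq_from_tnth => i; rewrite !tnth_mktuple invfM.
by rewrite mulrCA mulrA mulrA mulfV ?gt_eqF// mul1r.
Qed.

Lemma bernoulli (e : R) n : (0 <= e)%R -> (1 + n%:R * e <= (1 + e) ^+ n)%R.
Proof.
move=> e0; elim: n => [|n IH]; first by rewrite mul0r addr0 expr0.
rewrite exprS (le_trans _ (ler_wpM2l _ IH)) ?addr_ge0//.
have : (0 <= n%:R * e * e)%R by rewrite !mulr_ge0.
rewrite -[n.+1%:R]natr1; nra.
Qed.

(* With F(u) the integral of f(y/|y|) over the ball of radius u, homogeneity
   gives F(1+e) - F(1) = ((1+e)^n - 1) F(1), where n F(1) is the integral of f
   over the sphere. *)
Lemma integral_shell n (f : vec R n -> \bar R) (e : R) : (0 < n)%N -> (0 < e)%R ->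
  measurable_fun setT f -> (forall x, 0 <= f x) ->
  \int[@surface R n]_x f x < +oo ->
  e%:E * \int[@surface R n]_x f x <=
  \int[vol n]_(y in shell e) f (normalize y).
Proof.
move=> n0 e0 mf f0; rewrite ge0_integral_surface//.
pose g y := f (normalize y).
have mg : measurable_fun setT g by exact: (measurableT_comp mf
  (@measurable_normalize R n)).
pose F u := \int[vol n]_(y in [set y | (dot y y <= u ^+ 2)%R]) g y.
have F0 u : 0 <= F u by apply: integral_ge0 => y _; exact: f0.
have FB : \int[vol n]_(x in unit_ball) f (normalize x) = F 1%R.
  rewrite /F; congr integral; apply/seteqP.
  by split=> y; rewrite unit_ballE/= expr1n.
have FE u : (0 < u)%R -> F u = (u ^+ n)%:E * F 1%R.
  move=> u0; rewrite /F integral_mkcond.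
  pose z : vec R n := [tuple 0%R | i < n].
  have zE x : vaffine z u x = vscale u x.
    by apply: eq_from_tnth => i; rewrite !tnth_mktuple add0r.
  rewrite -(@ge0_integral_vaffine _ _ z u) ?gt_eqF//; last 2 first.
  - have mB : measurable [set y : vec R n | (dot y y <= u ^+ 2)%R].
      exact: measurable_dot_le.
    by apply: (measurable_restrictT _ mB).1; exact: measurable_funTS.
  - by move=> x; apply: erestrict_ge0 => y _; exact: f0.
  rewrite gtr0_norm//; congr (_ * _); rewrite [RHS]integral_mkcond.
  apply: eq_integral => x _; rewrite !patchE zE /g normalize_vscale//.
  have uE : dot (vscale u x) (vscale u x) = (u ^+ 2 * dot x x)%R.
    rewrite /dot mulr_sumr; apply: eq_bigr => i _.
    by rewrite !tnth_mktuple; ring.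
  have uu : (u ^+ 2 * dot x x <= u ^+ 2)%R = (dot x x <= 1)%R.
    by rewrite -[X in (_ <= X)%R]mulr1 ler_pM2l ?exprn_gt0// mulr1.
  by congr (if _ then _ else _); apply/idP/idP; rewrite !inE/= uE expr1n uu.
rewrite FB => Foo.
have F1 : F 1%R \is a fin_num.
  rewrite ge0_fin_numE//; move: Foo; case: (F 1%R) => // [r _|]; first by rewrite ltry.
  by rewrite gt0_muley// lte_fin ltr0n.
have : F (1 + e)%R = F 1%R + \int[vol n]_(y in shell e) g y.
  rewrite /F -ge0_integral_setU//.
  - congr integral; apply/seteqP; split => y /=; rewrite /shell/= expr1n.
      by move=> ye; case: (leP (dot y y) 1%R) => y1; [left|right; rewrite ?y1].
    case=> [y1|/andP[]//]; apply: (le_trans y1); nra.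
  - exact: measurable_dot_le.
  - exact: measurable_shell.
  - exact: measurable_funTS.
  - by move=> y _; exact: f0.
  - rewrite disj_set2E; apply/eqP; rewrite -subset0 => y /= []; rewrite /shell/= expr1n.
    by move=> y1 /andP[]; rewrite ltNge y1.
rewrite FE ?addr_gt0//; move: (F0 1%R); rewrite -(fineK F1) lee_fin => F10.
have -> : \int[vol n]_(y in shell e) f (normalize y) = \int[vol n]_(y in shell e) g
  y by [].
have : 0 <= \int[vol n]_(y in shell e) g y by apply: integral_ge0 => y _; exact: f0.
case: (integral _ (shell e) g) => [r||]// r0.
rewrite -EFinM -EFinD => -[rE]; rewrite -!EFinM lee_fin.
have := ler_wpM2r F10 (bernoulli n (ltW e0)); nra.
Qed.

End cone.

(** * The heat flux kernel on the sphere and just outside it *)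

Section kernel.
Context {R : realType} {n : nat}.
Implicit Types x y : vec R n.

(** This is a/(2t) times the heat kernel at squared distance D. The normal component a is kept
    separate from D because the relation a = D/2, valid on the sphere, fails on the shell, where a =
    (y - x).y. *)
Definition kernel_profile (a D t : R) : R :=
  a * ((2 ^+ n.+1 * pi `^ (n%:R / 2))^-1 * t `^ (- (1 + n%:R / 2))) *
  expR (- (D / 4 * t `^ (-1))).

(* The negative of heat_kernel_dnu on the sphere, in the form symmetric in x and
   y: there (x - y).x = |x - y|^2 / 2. The powers of t make it nonnegative
   everywhere. *)
Definition sphere_kernel x y (t : R) : R :=
  kernel_profile (dot (vsub x y) (vsub x y) / 2) (dot (vsub x y) (vsub x y)) t.

Lemma dotC x y : dot x y = dot y x.
Proof. by apply: eq_bigr => i _; rewrite mulrC. Qed.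

Lemma dot_vsub x y : dot (vsub x y) (vsub x y) = dot x x - 2 * dot x y + dot y y.
Proof.
rewrite /dot !mulr_sumr -sumrN -!big_split/=; apply: eq_bigr => i _.
by rewrite !tnth_mktuple; ring.
Qed.

Lemma dot_vadd x y : dot (vadd x y) (vadd x y) = dot x x + 2 * dot x y + dot y y.
Proof.
rewrite /dot !mulr_sumr -!big_split/=; apply: eq_bigr => i _.
by rewrite !tnth_mktuple; ring.
Qed.

Lemma dot_vsubl x y z : dot (vsub x y) z = dot x z - dot y z.
Proof.
rewrite /dot -sumrN -!big_split/=; apply: eq_bigr => i _.
by rewrite !tnth_mktuple; ring.
Qed.

Lemma dot_vscalel a x y : dot (vscale a x) y = a * dot x y.
Proof.
by rewrite /dot mulr_sumr; apply: eq_bigr => i _; rewrite tnth_mktuple mulrA.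
Qed.

Lemma dot_sphere x : sphere x -> dot x x = 1.
Proof. by rewrite /sphere/= -enorm_sqr => ->; rewrite expr1n. Qed.

Lemma kernel_profile_ge0 a D t : 0 <= a -> 0 <= kernel_profile a D t.
Proof.
move=> a0; rewrite /kernel_profile !mulr_ge0 ?expR_ge0 ?invr_ge0 ?mulr_ge0 ?powR_ge0//.
Qed.

Lemma sphere_kernel_ge0 x y t : 0 <= sphere_kernel x y t.
Proof. by apply: kernel_profile_ge0; rewrite divr_ge0 ?dot_ge0. Qed.

Lemma sphere_kernelC x y t : sphere_kernel x y t = sphere_kernel y x t.
Proof.
rewrite /sphere_kernel (_ : dot (vsub x y) _ = dot (vsub y x) (vsub y x))//.
by rewrite !dot_vsub dotC; ring.
Qed.

Lemma measurable_fun_powRl d (T : measurableType d) (t : T -> R) (p : R) :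
  measurable_fun setT t -> measurable_fun setT (fun z => t z `^ p).
Proof.
move=> mt; apply: (@measurableT_comp _ _ _ _ _ _ (powR (R:=R) ^~ p)) => //.
Qed.

Lemma measurable_kernel_profile d (T : measurableType d) (a D t : T -> R) :
  measurable_fun setT a -> measurable_fun setT D -> measurable_fun setT t ->
  measurable_fun setT (fun z => kernel_profile (a z) (D z) (t z)).
Proof.
move=> ma mD mt; apply: measurable_funM.
  apply: measurable_funM => //; apply: measurable_funM => //.
  exact: measurable_fun_powRl.
apply: measurableT_comp => //; apply: measurableT_comp => //.
apply: measurable_funM; first exact: measurable_funM.
exact: measurable_fun_powRl.
Qed.

Lemma measurable_sphere_kernel d (T : measurableType d) (f g : T -> vec R n)
    (t : T -> R) :
  measurable_fun setT f -> measurable_fun setT g -> measurable_fun setT t ->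
  measurable_fun setT (fun z => sphere_kernel (f z) (g z) (t z)).
Proof.
move=> mf mg mt; have mfg := measurable_fun_vsub mf mg.
apply: measurable_kernel_profile => //; last exact: measurable_fun_dot.
by apply: measurable_funM => //; exact: measurable_fun_dot.
Qed.

Lemma heat_kernel_dnu_sphere x y t : 0 < t -> sphere x -> sphere y ->
  heat_kernel_dnu x y t = - sphere_kernel x y t.
Proof.
move=> t0 /dot_sphere xS /dot_sphere yS; rewrite heat_kernel_dnuE// enorm_sqr.
rewrite /outward_normal dot_vsubl /sphere_kernel /kernel_profile dot_vsub xS yS.
rewrite [X in _ * X](_ : _ = expR (- ((1 - 2 * dot x y + 1) / 4 * t `^ (-1))));
  last first.
  rewrite powR_inv1 ?(ltW t0)//; congr expR; field; rewrite gt_eqF//.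
rewrite -[RHS]mulNr; congr (_ * _); rewrite (dotC y x) powRN.
have p1 : (2 : R) ^+ n.+1 != 0 by rewrite expf_neq0.
have p2 : (pi : R) `^ (n%:R / 2) != 0 by rewrite gt_eqF// powR_gt0// pi_gt0.
have p3 : t `^ (1 + n%:R / 2) != 0 by rewrite gt_eqF// powR_gt0.
by field; rewrite p1 p2 p3.
Qed.

(** A crude bound, meant only for finiteness: D/2 <= 2t (1 + D/(4t)) <= 2t exp(D/(4t)), so the
    exponential absorbs the factor D/2. *)
Lemma sphere_kernel_bound x y dl t T : 0 < dl -> dl <= t <= T ->
  sphere_kernel x y t <=
  2 * T * ((2 ^+ n.+1 * pi `^ (n%:R / 2))^-1 * dl `^ (- (1 + n%:R / 2))).
Proof.
move=> dl0 /andP[dt tT]; have t0 : 0 < t by exact: lt_le_trans dt.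
rewrite /sphere_kernel /kernel_profile; set D := dot _ _; set c := (2 ^+ n.+1 * _)^-1.
have c0 : 0 <= c by rewrite invr_ge0 mulr_ge0 ?powR_ge0// exprn_ge0.
rewrite mulrAC ler_pM ?mulr_ge0 ?powR_ge0 ?expR_ge0 ?divr_ge0 ?dot_ge0//.
  rewrite expRN ler_pdivrMr ?expR_gt0// powR_inv1 ?(ltW t0)//.
  have u1 := @expR_ge1Dx R (D / 4 * t^-1).
  have : D / 2 <= 2 * t * (1 + D / 4 * t^-1).
    rewrite (_ : _ * (1 + _) = 2 * t + D / 2); last by field; rewrite gt_eqF.
    by rewrite lerDr mulr_ge0// ltW.
  move=> h; apply: (le_trans h); rewrite ler_pM ?mulr_ge0 ?(ltW t0)//.
  - by rewrite addr_ge0// !mulr_ge0 ?dot_ge0 ?invr_ge0 ?(ltW t0).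
  - by rewrite ler_pM2l.
rewrite ler_wpM2l// !powRN lef_pV2 ?posrE ?powR_gt0//.
by rewrite ge0_ler_powR ?nnegrE ?(ltW t0) ?(ltW dl0)// addr_ge0// divr_ge0.
Qed.

(** Put rho = |y| and c = x.y/|y|, which lies in [-1, 1]. Passing from y/|y| to y raises the normal
    component by (rho - 1)(rho + 1 - c) >= 0 and the squared distance by (rho - 1)(rho + 1 - 2c) <=
    5e. The second change is the whole loss, and t >= dl makes it uniform. *)
Lemma sphere_kernel_shell (e dl t : R) x y : 0 < e <= 1 -> 0 < dl <= t ->
  sphere x -> shell e y ->
  expR (- (5 * e / (4 * dl))) * sphere_kernel x (normalize y) t <=
  kernel_profile (dot (vsub y x) y) (dot (vsub y x) (vsub y x)) t.
Proof.
move=> /andP[e0 e1] /andP[dl0 dlt] /dot_sphere xS.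
rewrite /shell/= => /andP[y1 ye]; have t0 : 0 < t by exact: lt_le_trans dlt.
set rho := enorm y; have r2 : dot y y = rho ^+ 2 by rewrite enorm_sqr.
have r1 : 1 < rho by rewrite -(@ltr_pXn2r _ 2) ?nnegrE ?enorm_ge0// expr1n -r2.
have re : rho <= 1 + e.
  by rewrite -(@ler_pXn2r _ 2) ?nnegrE ?enorm_ge0 ?addr_ge0 ?(ltW e0)// -r2.
have r0 : rho != 0 by rewrite gt_eqF// (lt_trans _ r1).
have wS : dot (normalize y) (normalize y) = 1.
  by apply: dot_sphere; rewrite /sphere/= enorm_normalize.
set c := dot x (normalize y).
have xy : dot x y = rho * c.
  by rewrite /c (dotC x (normalize y)) dot_vscalel mulrA mulfV// mul1r dotC.
have c1 : c <= 1.
  by have := dot_ge0 (vsub x (normalize y)); rewrite dot_vsub xS wS -/c; lra.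
have c2 : -1 <= c.
  by have := dot_ge0 (vadd x (normalize y)); rewrite dot_vadd xS wS -/c; lra.
rewrite /sphere_kernel dot_vsub xS wS -/c dot_vsubl dot_vsub r2 xS (dotC y x) xy.
rewrite /kernel_profile mulrCA -expRD.
rewrite ler_pM ?mulr_ge0 ?powR_ge0 ?expR_ge0 ?invr_ge0 ?mulr_ge0 ?powR_ge0//.
- lra.
- rewrite ler_wpM2r ?mulr_ge0 ?powR_ge0 ?invr_ge0 ?mulr_ge0 ?powR_ge0//; nra.
rewrite ler_expR powR_inv1 ?(ltW t0)// -opprD lerN2.
have h1 : rho ^+ 2 - 2 * (rho * c) + 1 <= (1 - 2 * c + 1) + 5 * e by nra.
apply: (@le_trans _ _ (((1 - 2 * c + 1) + 5 * e) / 4 * t^-1)).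
  by rewrite ler_wpM2r ?invr_ge0 ?(ltW t0)// ler_wpM2r ?invr_ge0.
rewrite mulrDl mulrDl addrC lerD2r invfM mulrA.
by rewrite ler_wpM2l ?divr_ge0 ?mulr_ge0 ?(ltW e0)// lef_pV2 ?posrE.
Qed.

End kernel.

(** * The squared distance to the origin along a ray from the sphere *)

Section radial_quadratic.
Context {R : realType}.
Variables (al be : R).
Hypothesis be0 : 0 <= be.
Local Notation mu := (@lebesgue_measure R).

(* v t is |x + sqrt t z|^2 for a unit vector x, al = x.z and be = |z|^2. *)
Definition vquad (t : R) : R := 1 + 2 * Num.sqrt t * al + t * be.

(** With p = sqrt t and q = sqrt s, the increment is (q - p)(2 al + (p + q) be), and v(t) >= 1 says
    exactly that p (2 al + p be) >= 0. *)
Lemma vquad_incr (s t : R) : 0 < t -> t <= s -> 1 <= vquad t -> vquad t <= vquad s.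
Proof.
move=> t0 ts; rewrite /vquad => v1.
have s0 : 0 < s by exact: lt_le_trans ts.
have := sqr_sqrtr (ltW t0); have := sqr_sqrtr (ltW s0).
have : Num.sqrt t <= Num.sqrt s by rewrite ler_sqrt ?(ltW s0).
have : 0 < Num.sqrt t by rewrite sqrtr_gt0.
move: v1; set p := Num.sqrt t; set q := Num.sqrt s => v1 p0 pq q2 p2.
have h : 0 <= 2 * al + p * be.
  rewrite -(pmulr_rge0 _ p0); move: v1; rewrite -p2; nra.
rewrite -q2 -p2 -subr_ge0.
rewrite (_ : _ - _ = (q - p) * (2 * al + p * be + q * be)); last by ring.
by rewrite mulr_ge0 ?subr_ge0// addr_ge0// mulr_ge0// (le_trans (ltW p0)).
Qed.

Lemma vquad_incr_lt (s t : R) : 0 < t -> t < s -> 1 < vquad t -> vquad t < vquad s.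
Proof.
move=> t0 ts; rewrite /vquad => v1.
have s0 : 0 < s by exact: lt_trans ts.
have := sqr_sqrtr (ltW t0); have := sqr_sqrtr (ltW s0).
have : Num.sqrt t < Num.sqrt s by rewrite ltr_sqrt ?s0.
have : 0 < Num.sqrt t by rewrite sqrtr_gt0.
move: v1; set p := Num.sqrt t; set q := Num.sqrt s => v1 p0 pq q2 p2.
have h : 0 < 2 * al + p * be.
  rewrite -(pmulr_rgt0 _ p0); move: v1; rewrite -p2; nra.
rewrite -q2 -p2 -subr_gt0.
rewrite (_ : _ - _ = (q - p) * (2 * al + p * be + q * be)); last by ring.
have q0 : 0 <= q := ltW (lt_trans p0 pq).
have qb := mulr_ge0 q0 be0.
apply: mulr_gt0; [by rewrite subr_gt0|lra].
Qed.

Lemma continuous_vquad : continuous vquad.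
Proof.
move=> t; apply: cvgD; last by apply: cvgM => //; exact: cvg_cst.
apply: cvgD; first exact: cvg_cst.
apply: cvgM; last exact: cvg_cst.
by apply: cvgM; [exact: cvg_cst|exact: sqrt_continuous].
Qed.

Definition vquad' (t : R) : R := (Num.sqrt t * al + t * be) * t `^ (-1).

Lemma is_derive_vquad (t : R) : 0 < t -> is_derive t 1 vquad (vquad' t).
Proof.
move=> t0; rewrite /vquad.
have ds := is_derive1_sqrt t0.
apply: (@is_derive_eq _ _ _ _ _ _ _ _).
have := sqr_sqrtr (ltW t0); have : Num.sqrt t != 0 by rewrite gt_eqF// sqrtr_gt0.
rewrite /vquad' powR_inv1 ?(ltW t0)// /GRing.scale/=; move: (Num.sqrt t) => p p0 <-.
by field.
Qed.

Lemma vquad'_ge0 (t : R) : 0 < t -> 1 <= vquad t -> 0 <= vquad' t.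
Proof.
move=> t0; rewrite /vquad /vquad' => v1; rewrite mulr_ge0 ?powR_ge0//.
have : 0 < Num.sqrt t by rewrite sqrtr_gt0.
have := sqr_sqrtr (ltW t0); move: v1; set p := Num.sqrt t => v1 p2 p0.
move: v1; rewrite -p2 => v1; have := mulr_ge0 (sqr_ge0 p) be0; nra.
Qed.

Lemma measurable_sqrt : measurable_fun setT (Num.sqrt : R -> R).
Proof. by apply: continuous_measurable_fun; exact: sqrt_continuous. Qed.

Lemma measurable_vquad : measurable_fun setT vquad.
Proof. by apply: continuous_measurable_fun; exact: continuous_vquad. Qed.

Lemma measurable_vquad' : measurable_fun setT vquad'.
Proof.
apply: measurable_funM; last exact: measurable_powR.
apply: measurable_funD; last exact: measurable_funM.
by apply: measurable_funM => //; exact: measurable_sqrt.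
Qed.

Local Open Scope ereal_scope.

(** By monotonicity the times with 1 < v <= c lie in one interval [a, b] on which v stays between 1
    and c, so the integral is at most v(b) - v(a) <= c - 1. If there is such a time at all, then
    v(dl) <= c and v(T) > 1, which accounts for the two indicators. *)
Lemma integral_vquad_crossing (dl T c : R) : (0 < dl)%R -> (dl <= T)%R -> (1 < c)%R ->
  \int[mu]_t ((dl <= t <= T)%R%:R * (1 < vquad t <= c)%R%:R * vquad' t)%:E <=
  ((c - 1) * ((vquad dl <= c)%R%:R * (1 < vquad T)%R%:R))%:E.
Proof.
move=> dl0 dlT c1.
have [[t0 /andP[/andP[dt tT] /andP[v1 vc]]]|noE] :=
    pselect (exists t, (dl <= t <= T) && (1 < vquad t <= c))%R; last first.
  rewrite integral0_eq.
    by rewrite lee_fin mulr_ge0// ?subr_ge0 ?(ltW c1)// mulr_ge0.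
  move=> t _; case: (boolP (dl <= t <= T)%R) => [tT|_]; last by rewrite !mul0r.
  case: (boolP (1 < vquad t <= c)%R) => [vt|_]; last by rewrite mulr0 mul0r.
  by case: noE; exists t; rewrite tT vt.
have t00 : (0 < t0)%R by exact: lt_le_trans dt.
have T0 : (0 < T)%R by exact: lt_le_trans tT.
have -> : (1 < vquad T)%R by rewrite (lt_le_trans v1)// vquad_incr// ltW.
have -> : (vquad dl <= c)%R.
  have [/ltW v|v] := ltP (vquad dl) 1%R; first by rewrite (le_trans v)// ltW.
  by rewrite (le_trans _ vc)// vquad_incr.
(* b is the last time with v <= c: either T, or the time where v reaches c. *)
have [b /andP[tb bT] [vb bmax]] : exists2 b, (t0 <= b <= T)%R & (vquad b <= c)%R /\
    forall t, (t <= T)%R -> (vquad t <= c)%R -> (t <= b)%R.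
  have [vT|vT] := leP (vquad T) c; first by exists T => //; rewrite tT lexx.
  have [||b] := @IVT R vquad t0 T c tT.
  - by apply: continuous_subspaceT; exact: continuous_vquad.
  - by rewrite ge_min vc/= le_max (ltW vT) orbT.
  rewrite in_itv/= => /andP[tb bT] vb; exists b; first by rewrite tb.
  split; first by rewrite vb.
  move=> t _; apply: contraTT; rewrite -!ltNge => bt; rewrite -vb.
  by apply: vquad_incr_lt => //; [exact: lt_le_trans tb|rewrite vb].
(* a precedes every time with v > 1: either dl, when v(dl) >= 1 already, or a time where v equals
   1. *)
have [a /andP[da at0] [va amin]] : exists2 a, (dl <= a <= t0)%R & (1 <= vquad a)%R /\
    forall t, (dl <= t)%R -> (1 < vquad t)%R -> (a <= t)%R.
  have [vd|vd] := leP 1%R (vquad dl); first by exists dl => //; rewrite lexx dt.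
  have [||a] := @IVT R vquad dl t0 1%R dt.
  - by apply: continuous_subspaceT; exact: continuous_vquad.
  - by rewrite ge_min (ltW vd)/= le_max (ltW v1) orbT.
  rewrite in_itv/= => /andP[da at0] va; exists a; first by rewrite da.
  split; first by rewrite va.
  move=> t td; apply: contraTT; rewrite -!ltNge -leNgt => ta; rewrite leNgt.
  apply/negP => vt.
  have := vquad_incr (lt_le_trans dl0 td) (ltW ta) (ltW vt).
  by rewrite va leNgt vt.
have a0 : (0 < a)%R by exact: lt_le_trans da.
have pos t : (a <= t)%R -> (0 <= vquad' t)%R.
  move=> a_t; have t1 := lt_le_trans a0 a_t.
  by apply: vquad'_ge0 => //; rewrite (le_trans va)// vquad_incr.
apply: (@le_trans _ _ (\int[mu]_(t in `[a, b]) (vquad' t)%:E)).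
  rewrite [leRHS]integral_mkcond; apply: ge0_le_integral => //.
  - move=> t _; rewrite lee_fin.
    case: (boolP (dl <= t <= T)%R) => [/andP[td _]|_]; last by rewrite !mul0r.
    case: (boolP (1 < vquad t <= c)%R) => [/andP[vt _]|_]; last by rewrite mulr0 mul0r.
    by rewrite !mul1r pos// amin.
  - apply/measurable_EFinP; apply: measurable_funM; last exact: measurable_vquad'.
    apply: measurable_funM; under eq_fun do rewrite -mulnb natrM.
      by apply: measurable_funM; exact: measurable_ler_indic.
    apply: measurable_funM.
      by apply: measurable_ltr_indic => //; exact: measurable_vquad.
    by apply: measurable_ler_indic => //; exact: measurable_vquad.
  - apply/(measurable_restrictT _ _).1 => //.
    by apply/measurable_EFinP; apply: measurable_funTS; exact: measurable_vquad'.
  move=> t _; rewrite patchE.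
  case: (boolP (dl <= t <= T)%R) => [/andP[td tT']|_]; last first.
    rewrite !mul0r; case: ifPn => //; rewrite inE/= in_itv/= => /andP[/pos].
    by rewrite lee_fin.
  case: (boolP (1 < vquad t <= c)%R) => [/andP[vt vtc]|_]; last first.
    rewrite mulr0 mul0r; case: ifPn => //; rewrite inE/= in_itv/= => /andP[/pos].
    by rewrite lee_fin.
  by rewrite !mul1r mem_set//= in_itv/= amin// bmax.
have [ab|ba] := ltP a b; last first.
  have /eqP ab : a == b by rewrite eq_le ba (le_trans at0 tb).
  rewrite ab set_itv1 integral_set1 lee_fin mulr_ge0// subr_ge0 ltW//.
have -> : \int[mu]_(t in `[a, b]) (vquad' t)%:E = (vquad b - vquad a)%:E;
  last by rewrite lee_fin !mulr1 lerB.
apply: integral_is_derive => //.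
- by move=> t /andP[a_t _]; apply: is_derive_vquad; exact: lt_le_trans a_t.
- move=> t /andP[a_t _]; have t1 := lt_le_trans a0 a_t.
  have cp : {for t, continuous (fun s : R => (s `^ (-1))%R)}.
    apply: differentiable_continuous; apply/derivable1_diffP.
    by apply: derivable_powR; rewrite in_itv/= t1.
  apply: cvgM; last exact: cp.
  apply: cvgD; last by apply: cvgM => //; exact: cvg_cst.
  by apply: cvgM; [exact: sqrt_continuous|exact: cvg_cst].
Qed.

End radial_quadratic.

(** * The Gaussian measure: total mass, half-spaces, the origin *)

Section gaussian.
Context {R : realType} {n : nat}.
Hypothesis n0 : (0 < n)%N.
Local Open Scope ereal_scope.
Local Notation mu := (@lebesgue_measure R).
Local Notation vol := (@lebesgue_vec R n).

(** The heat kernel at time 1: under this density, x + sqrt t z has the law of the heat kernel at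
    time t centred at x. *)
Definition gauss_density (z : vec R n) : R :=
  ((4 * pi) `^ (- (n%:R / 2)) * expR (- (dot z z / 4)))%R.

Lemma gauss_density_ge0 z : (0 <= gauss_density z)%R.
Proof. by rewrite mulr_ge0 ?powR_ge0 ?expR_ge0. Qed.

Lemma measurable_fun_gauss_density d (T : measurableType d) (f : T -> vec R n) :
  measurable_fun setT f -> measurable_fun setT (fun t => gauss_density (f t)).
Proof.
move=> mf; apply: measurable_funM => //.
apply: measurableT_comp => //; apply: measurableT_comp => //.
by apply: measurable_funM => //; exact: measurable_fun_dot.
Qed.

Lemma integral_gauss_density : \int[vol]_z (gauss_density z)%:E = 1.
Proof.
pose o : vec R n := [tuple 0%R | i < n].
have m1 : measurable_fun setT (EFin \o gauss_density).
  by apply/measurable_EFinP; exact: (measurable_fun_gauss_density (@measurable_id _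
    _ _)).
rewrite -(@ge0_integral_vaffine _ _ o 2 (EFin \o gauss_density))//; last first.
  by move=> z; rewrite lee_fin gauss_density_ge0.
transitivity ((`|2| ^+ n)%:E * \int[vol]_z (((4 * pi) `^ (- (n%:R / 2)))%:E * (expR
  (- dot z z))%:E)).
  congr (_ * _); apply: eq_integral => z _; rewrite -EFinM/= /gauss_density.
  have o0 w : dot o w = 0%R by rewrite /dot big1// => i _; rewrite tnth_mktuple mul0r.
  by congr (_ * expR (- _))%:E; rewrite dot_vaffine !o0; field.
rewrite ge0_integralZl_EFin ?powR_ge0//; last first.
  by apply/measurable_EFinP; apply: measurableT_comp => //;
    apply: measurableT_comp => //; exact: measurable_fun_dot.
rewrite integral_vec_gauss -!EFinM; congr EFin.
rewrite ger0_norm// -powR12_sqrt ?pi_ge0// -!powR_mulrn ?powR_ge0// -powRrM.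
rewrite powRN (_ : (2 : R) `^ n%:R = 4 `^ (n%:R / 2))%R; last first.
  rewrite (_ : 4 = 2 `^ 2%:R)%R; last by rewrite powR_mulrn//; ring.
  by rewrite -powRrM; congr powR; field.
rewrite powRM ?pi_ge0// [(2^-1 * _)%R]mulrC.
have p4 : ((4 : R) `^ (n%:R / 2) != 0)%R by rewrite gt_eqF// powR_gt0.
have pp : ((pi : R) `^ (n%:R / 2) != 0)%R by rewrite gt_eqF// powR_gt0// pi_gt0.
by field; rewrite p4 pp.
Qed.

(** The reflection z -> -z gives the opposite open half-space the same mass, and the two are
    disjoint in a total mass of 1. *)
Lemma gauss_half_space (x : vec R n) :
  \int[vol]_z ((dot x z < 0)%R%:R * gauss_density z)%:E <= (2^-1)%:E.
Proof.
have mz : measurable_fun setT (fun z : vec R n => z) := @measurable_id _ _ _.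
have mg := measurable_fun_gauss_density mz.
have mdx : measurable_fun setT (fun z => dot x z) by exact: measurable_fun_dot.
have mneg : measurable_fun setT (fun z => ((dot x z < 0)%R%:R * gauss_density z)%:E).
  by apply/measurable_EFinP; apply: measurable_funM => //; exact: measurable_ltr_indic.
have mpos : measurable_fun setT (fun z => ((0 < dot x z)%R%:R * gauss_density z)%:E).
  by apply/measurable_EFinP; apply: measurable_funM => //; exact: measurable_ltr_indic.
have gneg z : 0 <= ((dot x z < 0)%R%:R * gauss_density z)%:E.
  by rewrite lee_fin mulr_ge0// gauss_density_ge0.
have gpos z : 0 <= ((0 < dot x z)%R%:R * gauss_density z)%:E.
  by rewrite lee_fin mulr_ge0// gauss_density_ge0.
pose o : vec R n := [tuple 0%R | i < n].
have E : \int[vol]_z ((dot x z < 0)%R%:R * gauss_density z)%:E =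
         \int[vol]_z ((0 < dot x z)%R%:R * gauss_density z)%:E.
  rewrite -(@ge0_integral_vaffine _ _ o (-1) (fun z => ((dot x z < 0)%R%:R *
    gauss_density z)%:E))//.
  rewrite normrN1 expr1n mul1e; apply: eq_integral => z _.
  have o0 w : dot o w = 0%R by rewrite /dot big1// => i _; rewrite tnth_mktuple mul0r.
  have -> : dot x (vaffine o (-1) z) = (- dot x z)%R.
    by rewrite /dot -sumrN; apply: eq_bigr => i _; rewrite !tnth_mktuple; ring.
  rewrite oppr_lt0; congr (_ * _)%:E; rewrite /gauss_density; congr (_ * expR (- _))%R.
  by rewrite dot_vaffine !o0; field.
have : \int[vol]_z ((dot x z < 0)%R%:R * gauss_density z)%:E +
       \int[vol]_z ((dot x z < 0)%R%:R * gauss_density z)%:E <= 1.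
  rewrite {2}E -ge0_integralD// -integral_gauss_density; apply: ge0_le_integral => //.
  - by move=> z _; rewrite adde_ge0.
  - exact: emeasurable_funD.
  - exact/measurable_EFinP.
  - move=> z _; rewrite -EFinD lee_fin -mulrDl ler_piMl ?gauss_density_ge0//.
    by case: ltgtP; rewrite ?addr0 ?add0r.
have : 0 <= \int[vol]_z ((dot x z < 0)%R%:R * gauss_density z)%:E by exact:
  integral_ge0.
case: (integral _ _ _) => [r||]//=; rewrite -?EFinD !lee_fin => _; lra.
Qed.

(** Doubling maps the origin to itself, so its volume V is finite and satisfies V = 2^n V. The
    direction z = 0 has to be set aside because its ray never leaves the sphere. *)
Lemma gauss_origin :
  \int[vol]_z ((dot z z <= 0)%R%:R * gauss_density z)%:E = 0.
Proof.
pose A := [set z : vec R n | (dot z z <= 0)%R].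
have mA : measurable A by exact: measurable_dot_le.
have A0 : vol A = 0.
  pose o : vec R n := [tuple 0%R | i < n].
  have o0 w : dot o w = 0%R by rewrite /dot big1// => i _; rewrite tnth_mktuple mul0r.
  have mI : measurable_fun setT (fun z => (\1_A z : R)%:E).
    by apply/measurable_EFinP; exact: measurable_indic.
  have : vol A = (2 ^+ n)%:E * vol A.
    rewrite -{1}integral_indicT// -(@ge0_integral_vaffine _ _ o 2 _ _ mI)//.
    rewrite ger0_norm//; congr (_ * _); rewrite -integral_indicT//.
    apply: eq_integral => z _; rewrite !indicE; congr (nat_of_bool _)%:R%:E.
    have e4 : (2 ^+ 2 * dot z z <= 0 = (dot z z <= 0))%R by rewrite pmulr_rle0.
    by apply/idP/idP; rewrite !inE /A/= dot_vaffine !o0 mulr0 !add0r e4.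
  have Afin : vol A \is a fin_num.
    rewrite ge0_fin_numE//; apply: le_lt_trans (@volume_unit_ball_lty R n).
    apply: le_measure; rewrite ?inE//; first exact: measurable_unit_ball.
    by move=> z; rewrite /A/= unit_ballE => /le_trans; apply.
  rewrite -(fineK Afin) -EFinM => -[E]; congr EFin.
  have n2 : (1 < 2 ^+ n :> R)%R by rewrite exprn_egt1 ?ltr1n ?lt0n_neq0.
  have /eqP : ((2 ^+ n - 1) * fine (vol A) = 0)%R by rewrite mulrBl mul1r -E subrr.
  by rewrite mulf_eq0 subr_eq0 gt_eqF//= => /eqP.
have -> : \int[vol]_z ((dot z z <= 0)%R%:R * gauss_density z)%:E =
          \int[vol]_(z in A) (gauss_density z)%:E.
  by rewrite [RHS](@integral_pred _ _ _ _ _ (fun z : vec R n => dot z z <= 0)%R).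
apply: null_set_integral => //; apply: measurable_funTS.
apply/measurable_EFinP; exact: (measurable_fun_gauss_density (@measurable_id _ _ _)).
Qed.

End gaussian.

(** * The Gaussian mass of the unit ball at time T and the stability constant *)

Section ball_mass.
Context {R : realType} {n : nat}.
Hypothesis n0 : (0 < n)%N.
Local Open Scope ereal_scope.
Local Notation vol := (@lebesgue_vec R n).

Lemma dot_vaffine_sphere (x z : vec R n) (t : R) : sphere x -> (0 <= t)%R ->
  dot (vaffine x (Num.sqrt t) z) (vaffine x (Num.sqrt t) z) =
  vquad (dot x z) (dot z z) t.
Proof.
by move=> /dot_sphere xS t0; rewrite dot_vaffine xS sqr_sqrtr.
Qed.

Lemma vsub_vaffine (x z : vec R n) b : vsub (vaffine x b z) x = vscale b z.
Proof. by apply: eq_from_tnth => i; rewrite !tnth_mktuple; ring. Qed.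

Lemma dot_vscale a (z : vec R n) : dot (vscale a z) (vscale a z) = (a ^+ 2 * dot z z)%R.
Proof. by rewrite dot_vscalel dotC dot_vscalel mulrA -expr2. Qed.

Lemma measurable_fun_vquad d (T : measurableType d) (a b t : T -> R) :
  measurable_fun setT a -> measurable_fun setT b -> measurable_fun setT t ->
  measurable_fun setT (fun z => vquad (a z) (b z) (t z)).
Proof.
move=> ma mb mt; apply: measurable_funD; last exact: measurable_funM.
apply: measurable_funD => //; apply: measurable_funM => //.
by apply: measurable_funM => //; exact: (measurableT_comp measurable_sqrt mt).
Qed.

Definition stability_constant (T : R) : R :=
  (expR 1 * n%:R * 2 ^+ n.-1 * Gamma (n%:R / 2) * T `^ (n%:R / 2))%R.

Lemma stability_constant_gt0 T : (0 < T)%R -> (0 < stability_constant T)%R.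
Proof.
move=> T0; have [G0 _] := @volume_unit_ball_Gamma R n n0.
by rewrite !mulr_gt0 ?expR_gt0 ?ltr0n ?powR_gt0 ?exprn_gt0.
Qed.

Lemma gauss_ball_mass (x : vec R n) (T : R) : sphere x -> (1 <= T)%R ->
  ((stability_constant T)^-1)%:E <=
  \int[vol]_z ((vquad (dot x z) (dot z z) T <= 1)%R%:R * gauss_density z)%:E.
Proof.
move=> xS T1; have T0 : (0 < T)%R by exact: lt_le_trans T1.
have sT : (0 < Num.sqrt T)%R by rewrite sqrtr_gt0.
have mz : measurable_fun setT (fun z : vec R n => z) := @measurable_id _ _ _.
pose c : R := ((4 * pi) `^ (- (n%:R / 2)))%R.
have c0 : (0 <= c)%R by exact: powR_ge0.
pose f (y : vec R n) := ((dot y y <= 1)%R%:R *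
  (c * expR (- (dot (vsub y x) (vsub y x) / (4 * T)))))%R.
have mf : measurable_fun setT (EFin \o f).
  apply/measurable_EFinP; apply: measurable_funM.
    by apply: measurable_ler_indic => //; exact: measurable_fun_dot.
  apply: measurable_funM => //; apply: measurableT_comp => //.
  apply: measurableT_comp => //; apply: measurable_funM => //.
  by apply: measurable_fun_dot; exact: measurable_fun_vsub.
have f0 y : 0 <= (EFin \o f) y.
  by rewrite lee_fin !mulr_ge0// expR_ge0.
have := @ge0_integral_vaffine _ _ x (Num.sqrt T) (EFin \o f) _ mf f0.
rewrite gt_eqF// => /(_ isT).
have -> : \int[vol]_z (EFin \o f) (vaffine x (Num.sqrt T) z) =
    \int[vol]_z ((vquad (dot x z) (dot z z) T <= 1)%R%:R * gauss_density z)%:E.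
  apply: eq_integral => z _; rewrite /= /f dot_vaffine_sphere ?(ltW T0)//.
  congr (_ * (_ * expR (- _)))%:E; rewrite vsub_vaffine dot_vscale sqr_sqrtr ?(ltW
    T0)//.
  by field; rewrite gt_eqF.
set I := \int[vol]_z _ => IE.
have fB : (c * expR (- 1))%:E * vol unit_ball <= \int[vol]_y (EFin \o f) y.
  rewrite -integral_indicT; last exact: measurable_unit_ball.
  rewrite -ge0_integralZl_EFin ?mulr_ge0 ?expR_ge0//; last first.
    by apply/measurable_EFinP; apply: measurable_indic; exact: measurable_unit_ball.
  apply: ge0_le_integral => //.
  - by move=> y _; rewrite -EFinM lee_fin !mulr_ge0// expR_ge0.
  - apply: measurable_funeM; apply/measurable_EFinP.
    by apply: measurable_indic; exact: measurable_unit_ball.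
  move=> y _; rewrite -EFinM lee_fin /f indicE.
  have [|] := boolP (y \in unit_ball); last first.
    by rewrite mulr0 !mulr_ge0// expR_ge0.
  rewrite inE unit_ballE => y1; rewrite mulr1 y1 mul1r ler_wpM2l// ler_expR lerN2.
  (* Parallelogram identity: |y - x|^2 + |y + x|^2 = 2|y|^2 + 2 <= 4 <= 4T. *)
  rewrite ler_pdivrMr ?mulr_gt0// mul1r dot_vsub (dot_sphere xS).
  have := dot_ge0 (vadd y x); rewrite dot_vadd (dot_sphere xS); nra.
have [G0 volE] := @volume_unit_ball_Gamma R n n0.
move: fB; rewrite volE -IE gtr0_norm// -EFinM.
have : 0 <= I by apply: integral_ge0 => z _; rewrite lee_fin mulr_ge0//
  gauss_density_ge0.
case: I {IE} => [r|_ _|]//; last by rewrite leey.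
rewrite -!EFinM !lee_fin => r0.
rewrite -powR_mulrn ?sqrtr_ge0// -powR12_sqrt ?(ltW T0)// -powRrM [(2^-1 * _)%R]mulrC.
set p := (n%:R / 2)%R; have Tp : (0 < T `^ p)%R by rewrite powR_gt0.
rewrite -ler_pdivrMl// /c powRN powRM ?pi_ge0// -/p.
(* The split-off 2 cancels the denominator of n/2 and leaves the 2^(n-1) of the constant. *)
have p4 : ((4 : R) `^ p = 2 * 2 ^+ n.-1)%R.
  rewrite -exprS prednK// (_ : 4 = 2 `^ 2%:R)%R; last by rewrite powR_mulrn//; ring.
  by rewrite -powRrM /p mulrCA mulfV// mulr1 powR_mulrn.
have pp : (0 < (pi : R) `^ p)%R by rewrite powR_gt0// pi_gt0.
have p2 : (0 < 2 ^+ n.-1 :> R)%R by rewrite exprn_gt0.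
have nn : (0 < n%:R :> R)%R by rewrite ltr0n.
apply: le_trans; rewrite le_eqVlt; apply/orP; left; apply/eqP.
rewrite /stability_constant -/p p4 expRN; move: G0 Tp pp p2 (expR_gt0 (1 : R)).
rewrite -/p; move: (Gamma p) (T `^ p)%R ((pi : R) `^ p)%R (expR 1) (2 ^+ n.-1)%R.
move=> G tp q w e1 G0 Tp q0 w0 e10; rewrite /p; field; rewrite !gt_eqF//.
Qed.

End ball_mass.

(** * The outward flux through a shell and the crossing event *)

Section row_bound.
Context {R : realType} {n : nat}.
Hypothesis n0 : (0 < n)%N.
Local Open Scope ereal_scope.
Local Notation mu := (@lebesgue_measure R).
Local Notation vol := (@lebesgue_vec R n).

Definition truncated_kernel (dl T : R) (x y : vec R n) (t : R) : R :=
  ((dl <= t <= T)%R%:R * sphere_kernel x y t)%R.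

Lemma measurable_itv_indic d (S : measurableType d) (a b : R) (t : S -> R) :
  measurable_fun setT t -> measurable_fun setT (fun z => (a <= t z <= b)%R%:R : R).
Proof.
move=> mt; under eq_fun do rewrite -mulnb natrM.
by apply: measurable_funM; exact: measurable_ler_indic.
Qed.

Lemma measurable_truncated_kernel dl T d (S : measurableType d)
    (f g : S -> vec R n) (t : S -> R) :
  measurable_fun setT f -> measurable_fun setT g -> measurable_fun setT t ->
  measurable_fun setT (fun z => truncated_kernel dl T (f z) (g z) (t z)).
Proof.
move=> mf mg mt; apply: measurable_funM; first exact: measurable_itv_indic.
exact: measurable_sphere_kernel.
Qed.

Lemma truncated_kernel_ge0 dl T x y t : (0 <= truncated_kernel dl T x y t)%R.
Proof. by rewrite mulr_ge0// sphere_kernel_ge0. Qed.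

Definition time_kernel (dl T : R) (x y : vec R n) : \bar R :=
  \int[mu]_t (truncated_kernel dl T x y t)%:E.

Lemma time_kernel_ge0 dl T x y : 0 <= time_kernel dl T x y.
Proof. by apply: integral_ge0 => t _; rewrite lee_fin truncated_kernel_ge0. Qed.

Lemma measurable_time_kernel dl T x : measurable_fun setT (time_kernel dl T x).
Proof.
apply: (@measurable_fun_fubini_tonelli_F _ _ _ _ _ mu
  (fun p : vec R n * measurableTypeR R => (truncated_kernel dl T x p.1 p.2)%:E)).
  by apply/measurable_EFinP; apply: measurable_truncated_kernel.
by move=> p; rewrite lee_fin truncated_kernel_ge0.
Qed.

(** This is the finiteness hypothesis of [integral_shell]; the cut-off dl > 0 keeps the kernel
    bounded. *)
Lemma integral_time_kernel_lty dl T x : (0 < dl)%R -> (dl <= T)%R ->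
  \int[@surface R n]_y time_kernel dl T x y < +oo.
Proof.
move=> dl0 dT; have T0 : (0 < T)%R by exact: lt_le_trans dT.
pose B : R := (2 * T * ((2 ^+ n.+1 * pi `^ (n%:R / 2))^-1 * dl `^ (- (1 + n%:R /
  2))))%R.
have B0 : (0 <= B)%R.
  rewrite /B !mulr_ge0 ?invr_ge0 ?mulr_ge0 ?powR_ge0 ?(ltW T0)//.
have K y : time_kernel dl T x y <= (B * (T - dl))%:E.
  apply: (@le_trans _ _ (\int[mu]_(t in `[dl, T]) cst B%:E t)).
    rewrite [leRHS]integral_mkcond; apply: ge0_le_integral => //.
    - by move=> t _; rewrite lee_fin truncated_kernel_ge0.
    - by apply/measurable_EFinP; apply: measurable_truncated_kernel.
    - by apply/(measurable_restrictT _ _).1.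
    move=> t _; rewrite patchE /truncated_kernel.
    case: (boolP (dl <= t <= T)%R) => dtT.
      by rewrite mem_set/= ?in_itv//= mul1r lee_fin sphere_kernel_bound.
    by rewrite mul0r; case: ifPn => // _; rewrite lee_fin.
  rewrite integral_cst//= lebesgue_measure_itv/= lte_fin.
  case: ifPn => _; first by rewrite -EFinD -EFinM.
  by rewrite mule0 lee_fin mulr_ge0// subr_ge0.
apply: (@le_lt_trans _ _ (\int[@surface R n]_y cst (B * (T - dl))%:E y)).
  apply: ge0_le_integral => //; first by move=> y _; exact: time_kernel_ge0.
  exact: measurable_time_kernel.
rewrite integral_cst//=; apply: lte_mul_pinfty => //.
- by rewrite lee_fin mulr_ge0// subr_ge0.
- by rewrite ltey_eq fin_num_measure.
Qed.

(** The exit event proper is c = 1; a larger c is the squared outer radius of a shell of positive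
    thickness. *)
Definition crossing (dl T c : R) (x z : vec R n) : R :=
  ((vquad (dot x z) (dot z z) dl <= c)%R%:R *
   (1 < vquad (dot x z) (dot z z) T)%R%:R)%R.

Lemma measurable_crossing dl T c x : measurable_fun setT (crossing dl T c x).
Proof.
have md : measurable_fun setT (fun z : vec R n => dot z z) by exact: measurable_fun_dot.
have mx : measurable_fun setT (fun z : vec R n => dot x z) by exact: measurable_fun_dot.
apply: measurable_funM.
  by apply: measurable_ler_indic => //; exact: measurable_fun_vquad.
by apply: measurable_ltr_indic => //; exact: measurable_fun_vquad.
Qed.

(** The flux is taken along y rather than along the unit vector y/|y|: this is what makes it an
    exact time derivative after the substitution. *)
Definition shell_flux (dl T c : R) (x : vec R n) (p : vec R n * measurableTypeR R)
  : R :=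
  ((dl <= p.2 <= T)%R%:R * (1 < dot p.1 p.1 <= c)%R%:R *
   kernel_profile (n := n) (dot (vsub p.1 x) p.1) (dot (vsub p.1 x) (vsub p.1 x))
     p.2)%R.

Lemma measurable_shell_indic d (S : measurableType d) (c : R) (f : S -> R) :
  measurable_fun setT f -> measurable_fun setT (fun z => (1 < f z <= c)%R%:R : R).
Proof.
move=> mf; under eq_fun do rewrite -mulnb natrM.
by apply: measurable_funM; [exact: measurable_ltr_indic|exact: measurable_ler_indic].
Qed.

Lemma measurable_shell_flux dl T c x :
  measurable_fun setT (EFin \o shell_flux dl T c x).
Proof.
have mvx := measurable_fun_vsub (@measurable_fst _ _ (vec R n) (measurableTypeR R))
  (@measurable_cst _ _ _ _ _ x).
apply/measurable_EFinP; apply: measurable_funM.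
  apply: measurable_funM; first exact: measurable_itv_indic.
  by apply: measurable_shell_indic; exact: measurable_fun_dot.
by apply: measurable_kernel_profile => //; exact: measurable_fun_dot.
Qed.

Lemma shell_flux_ge0 dl T c x p : sphere x -> 0 <= (EFin \o shell_flux dl T c x) p.
Proof.
move=> xS; rewrite lee_fin /shell_flux.
case: (boolP (1 < dot p.1 p.1 <= c)%R) => [/andP[p1 _]|_]; last first.
  by rewrite mulr0 mul0r.
rewrite mulr1 mulr_ge0// kernel_profile_ge0// dot_vsubl.
have := dot_ge0 (vsub p.1 x); rewrite dot_vsub (dot_sphere xS) (dotC x); lra.
Qed.

(* Substituting y = x + sqrt t z turns the normal flux through the shell into
   the time derivative of |x + sqrt t z|^2 / 2 under the Gaussian measure of z. *)
Lemma integral_shell_flux (dl T c : R) (x : vec R n) : (0 < dl)%R -> (dl <= T)%R ->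
  (1 < c)%R -> sphere x ->
  \int[vol]_y \int[mu]_t (EFin \o shell_flux dl T c x) (y, t) <=
  ((c - 1) / 2)%:E * \int[vol]_z (crossing dl T c x z * gauss_density z)%:E.
Proof.
move=> dl0 dlT c1 xS; pose F := shell_flux dl T c x.
have mSnd := @measurable_snd _ _ (vec R n) (measurableTypeR R).
have mF : measurable_fun setT (EFin \o F) := measurable_shell_flux dl T c x.
have F0 p : 0 <= (EFin \o F) p by exact: shell_flux_ge0.
pose G (p : vec R n * measurableTypeR R) := (gauss_density p.1 / 2 *
  ((dl <= p.2 <= T)%R%:R * (1 < vquad (dot x p.1) (dot p.1 p.1) p.2 <= c)%R%:R *
   vquad' (dot x p.1) (dot p.1 p.1) p.2))%R.
have md1 : measurable_fun setT (fun p : vec R n * measurableTypeR R => dot p.1 p.1).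
  exact: measurable_fun_dot.
have mdx : measurable_fun setT (fun p : vec R n * measurableTypeR R => dot x p.1).
  exact: measurable_fun_dot.
have mG : measurable_fun setT (EFin \o G).
  apply/measurable_EFinP; apply: measurable_funM.
    by apply: measurable_funM => //; exact: measurable_fun_gauss_density.
  apply: measurable_funM.
    apply: measurable_funM; first exact: measurable_itv_indic.
    by apply: measurable_shell_indic; exact: measurable_fun_vquad.
  apply: measurable_funM; last exact: measurable_fun_powRl.
  apply: measurable_funD; last exact: measurable_funM.
  by apply: measurable_funM => //; exact: (measurableT_comp measurable_sqrt mSnd).
have G0 p : 0 <= (EFin \o G) p.
  rewrite lee_fin /G; case: (boolP (dl <= p.2 <= T)%R) => [/andP[p1 _]|_]; last first.
    by rewrite !mul0r mulr0.
  case: (boolP (1 < vquad _ _ _ <= c)%R) => [/andP[v1 _]|_]; last first.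
    by rewrite mulr0 mul0r mulr0.
  rewrite !mul1r mulr_ge0// ?divr_ge0 ?gauss_density_ge0//.
  apply: vquad'_ge0; [exact: dot_ge0|exact: lt_le_trans p1|exact: ltW].
rewrite (fubini_tonelli (EFin \o F))//.
have -> : \int[mu]_t \int[vol]_y (EFin \o F) (y, t) =
          \int[mu]_t \int[vol]_z (EFin \o G) (z, t).
  apply: eq_integral => t _.
  case: (boolP (dl <= t <= T)%R) => [dtT|ndtT]; last first.
    rewrite !integral0_eq// => z _; rewrite /= ?/F ?/shell_flux ?/G/= (negbTE ndtT).
      by rewrite !mul0r mulr0.
    by rewrite !mul0r.
  have t0 : (0 < t)%R by case/andP: dtT => dt _; exact: lt_le_trans dt.
  have st : (0 < Num.sqrt t)%R by rewrite sqrtr_gt0.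
  have mFt : measurable_fun setT (fun y => (EFin \o F) (y, t)).
    exact: (measurableT_comp mF (@pair2_measurable _ _ (vec R n) (measurableTypeR
      R) t)).
  rewrite -(@ge0_integral_vaffine _ _ x (Num.sqrt t) _ _ mFt) ?gt_eqF//.
  have mFtx : measurable_fun setT (fun z => (EFin \o F) (vaffine x (Num.sqrt t) z, t)).
    exact: (measurableT_comp mFt (measurable_vaffine x _)).
  rewrite -ge0_integralZl_EFin ?exprn_ge0//.
  apply: eq_integral => z _; rewrite -EFinM /= /F /shell_flux /G/= dtT !mul1r;
    congr EFin.
  rewrite dot_vaffine_sphere ?(ltW t0)// vsub_vaffine dot_vscale.
  rewrite dot_vscalel sqr_sqrtr ?(ltW t0)// gtr0_norm//.
  rewrite mulrCA [RHS]mulrCA; congr (_ * _)%R.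
  have -> : dot z (vaffine x (Num.sqrt t) z) = (dot x z + Num.sqrt t * dot z z)%R.
    rewrite /dot mulr_sumr -big_split/=; apply: eq_bigr => i _.
    by rewrite !tnth_mktuple; ring.
  rewrite /kernel_profile /gauss_density /vquad'.
  have -> : (t * dot z z / 4 * t `^ (-1) = dot z z / 4)%R.
    by rewrite powR_inv1 ?(ltW t0)//; field; rewrite gt_eqF.
  have -> : (Num.sqrt t ^+ n = t `^ (n%:R / 2))%R.
    by rewrite -powR_mulrn ?sqrtr_ge0// -powR12_sqrt ?(ltW t0)// -powRrM mulrC.
  rewrite opprD powRD; last by rewrite (gt_eqF t0) implybT.
  rewrite !powRN powRM ?pi_ge0//.
  have -> : ((4 : R) `^ (n%:R / 2) = 2 ^+ n)%R.
    rewrite (_ : 4 = 2 `^ 2%:R)%R; last by rewrite powR_mulrn//; ring.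
    by rewrite -powRrM mulrCA mulfV// mulr1 powR_mulrn.
  have s2 := sqr_sqrtr (ltW t0); rewrite exprS powRr1 ?(ltW t0)//.
  have p2 : (0 < 2 ^+ n :> R)%R by rewrite exprn_gt0.
  have pp : (0 < (pi : R) `^ (n%:R / 2))%R by rewrite powR_gt0// pi_gt0.
  have tt : (0 < t `^ (n%:R / 2))%R by rewrite powR_gt0.
  move: s2 st (expR _) p2 pp tt; move: (Num.sqrt t) => s s2 st.
  move: (t `^ _)%R (pi `^ _)%R (2 ^+ n)%R => tp pp w ex w0 pp0 tp0.
  rewrite -s2; field; rewrite !gt_eqF//.
rewrite -(fubini_tonelli (EFin \o G))//.
have mcr : measurable_fun setT (fun z => (crossing dl T c x z * gauss_density z)%:E).
  apply/measurable_EFinP; apply: measurable_funM; first exact: measurable_crossing.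
  exact: measurable_fun_gauss_density.
have cr0 z : 0 <= (crossing dl T c x z * gauss_density z)%:E.
  by rewrite lee_fin mulr_ge0 ?gauss_density_ge0// mulr_ge0.
rewrite -ge0_integralZl_EFin ?divr_ge0 ?subr_ge0 ?(ltW c1)//.
apply: ge0_le_integral => //.
- by move=> z _; exact: integral_ge0.
- exact: (measurable_fun_fubini_tonelli_F (EFin \o G)).
- exact: measurable_funeM.
move=> z _; have mz : measurable_fun setT (fun t : measurableTypeR R => dot z z).
  exact: measurable_cst.
have g0 : (0 <= gauss_density z / 2)%R by rewrite divr_ge0 ?gauss_density_ge0.
rewrite (_ : \int[mu]_t (EFin \o G) (z, t) = (gauss_density z / 2)%:E *
   \int[mu]_t ((dl <= t <= T)%R%:R * (1 < vquad (dot x z) (dot z z) t <= c)%R%:R *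
     vquad' (dot x z) (dot z z) t)%:E); last first.
  rewrite -ge0_integralZl_EFin//.
  - move=> t _; rewrite lee_fin.
    case: (boolP (dl <= t <= T)%R) => [/andP[p1 _]|_]; last by rewrite !mul0r.
    case: (boolP (1 < vquad _ _ _ <= c)%R) => [/andP[v1 _]|_]; last first.
      by rewrite mulr0 mul0r.
    rewrite !mul1r; apply: vquad'_ge0; [exact: dot_ge0|exact: lt_le_trans p1|exact:
      ltW].
  - apply/measurable_EFinP; apply: measurable_funM; last exact: measurable_vquad'.
    apply: measurable_funM; first exact: measurable_itv_indic.
    by apply: measurable_shell_indic; exact: measurable_vquad.
apply: (@le_trans _ _ ((gauss_density z / 2)%:E * ((c - 1) * crossing dl T c x z)%:E)).
  by rewrite lee_wpmul2l ?lee_fin// integral_vquad_crossing// dot_ge0.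
by rewrite -!EFinM lee_fin le_eqVlt; apply/orP; left; apply/eqP; field.
Qed.

End row_bound.

(** * The mass of the kernel over a time interval away from 0 *)

Section kernel_mass.
Context {R : realType} {n : nat}.
Hypothesis n0 : (0 < n)%N.
Local Open Scope ereal_scope.
Local Notation mu := (@lebesgue_measure R).
Local Notation vol := (@lebesgue_vec R n).
Local Notation crossing_mass dl T c x :=
  (\int[vol]_z (crossing dl T c x z * gauss_density z)%:E).

Lemma crossing_density_ge0 dl T c (x z : vec R n) :
  0 <= (crossing dl T c x z * gauss_density z)%:E.
Proof. by rewrite lee_fin mulr_ge0 ?gauss_density_ge0// mulr_ge0. Qed.

Lemma crossing_density_le dl T c (x z : vec R n) :
  (crossing dl T c x z * gauss_density z)%:E <= (gauss_density z)%:E.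
Proof.
rewrite lee_fin ler_piMl ?gauss_density_ge0// /crossing.
by rewrite -natrM mulnb lern1 leq_b1.
Qed.

Lemma measurable_crossing_density dl T c (x : vec R n) :
  measurable_fun setT (fun z => (crossing dl T c x z * gauss_density z)%:E).
Proof.
apply/measurable_EFinP; apply: measurable_funM; first exact: measurable_crossing.
exact: measurable_fun_gauss_density.
Qed.

Lemma measurable_gauss_density : measurable_fun setT (EFin \o @gauss_density R n).
Proof. by apply/measurable_EFinP; exact: measurable_fun_gauss_density. Qed.

Lemma crossing_mass_fin dl T c (x : vec R n) : crossing_mass dl T c x \is a fin_num.
Proof.
rewrite ge0_fin_numE; last by apply: integral_ge0 => z _; exact: crossing_density_ge0.
apply: (@le_lt_trans _ _ (\int[vol]_z (gauss_density z)%:E)); last first.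
  by rewrite integral_gauss_density ltry.
apply: ge0_le_integral => //.
- by move=> z _; exact: crossing_density_ge0.
- exact: measurable_crossing_density.
- exact: measurable_gauss_density.
- by move=> z _; exact: crossing_density_le.
Qed.

(** Joins the cone estimate, the comparison of kernels and the flux bound at c = (1 + e)^2. Since (c
    - 1)/2 = e (1 + e/2), the thickness e cancels. *)
Lemma shell_bound (dl T e : R) (x : vec R n) : (0 < dl)%R -> (dl <= T)%R ->
  (0 < e <= 1)%R -> sphere x ->
  (expR (- (5 * e / (4 * dl))))%:E * \int[@surface R n]_y time_kernel dl T x y <=
  (1 + e / 2)%:E * crossing_mass dl T ((1 + e) ^+ 2) x.
Proof.
move=> dl0 dlT /[dup] e01 /andP[e0 e1] xS.
have c1 : (1 < (1 + e) ^+ 2)%R by nra.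
set q := expR _; have q0 : (0 <= q)%R by exact: expR_ge0.
rewrite -(@lee_pmul2l _ e%:E)//.
rewrite muleCA [leRHS]muleA -EFinM.
rewrite [X in _ <= X * _](_ : _ = ((((1 + e) ^+ 2 - 1) / 2)%R)%:E); last first.
  by congr EFin; field.
apply: le_trans (integral_shell_flux dl0 dlT c1 xS).
have mh := @measurable_time_kernel R n dl T x.
have mhn : measurable_fun setT (fun y => time_kernel dl T x (normalize y)).
  exact: (measurableT_comp mh (@measurable_normalize R n)).
apply: (@le_trans _ _ (q%:E * \int[vol]_(y in shell e) time_kernel dl T x
  (normalize y))).
  apply: lee_wpmul2l; first by rewrite lee_fin.
  apply: integral_shell => //; first by move=> y; exact: time_kernel_ge0.
  exact: integral_time_kernel_lty.
rewrite -ge0_integralZl_EFin; last 4 first.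
- exact: measurable_shell.
- by move=> y _; exact: time_kernel_ge0.
- exact: measurable_funTS.
- exact: q0.
rewrite integral_mkcond; apply: ge0_le_integral; first exact: measurableT.
- by move=> y _; apply: erestrict_ge0 => z _; rewrite mule_ge0 ?lee_fin
  ?time_kernel_ge0.
- apply: (measurable_restrictT _ (measurable_shell _)).1.
  by apply: measurable_funTS; exact: measurable_funeM.
- exact: (measurable_fun_fubini_tonelli_F _ (measurable_shell_flux _ _ _ _)
    (fun p => shell_flux_ge0 _ _ _ p xS)).
move=> y _; rewrite patchE; case: ifPn => [|_]; last first.
  by apply: integral_ge0 => t _; exact: shell_flux_ge0.
rewrite inE => ye; rewrite -ge0_integralZl_EFin//; last 2 first.
- by move=> t _; rewrite lee_fin truncated_kernel_ge0.
- by apply/measurable_EFinP; exact: measurable_truncated_kernel.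
apply: ge0_le_integral => //.
- by move=> t _; rewrite -EFinM lee_fin mulr_ge0// truncated_kernel_ge0.
- apply: measurable_funeM; apply/measurable_EFinP.
  exact: measurable_truncated_kernel.
- exact: (measurableT_comp (measurable_shell_flux _ _ _ _)
    (@pair1_measurable _ _ (vec R n) (measurableTypeR R) y)).
move=> t _; rewrite -EFinM lee_fin /truncated_kernel /shell_flux/=.
have /andP[-> ->] : (1 < dot y y <= (1 + e) ^+ 2)%R by [].
rewrite mulr1; case: (boolP (dl <= t <= T)%R) => [/andP[dt _]|_]; last first.
  by rewrite !mul0r mulr0.
by rewrite !mul1r; apply: sphere_kernel_shell => //; rewrite dl0.
Qed.

(** The condition v(dl) <= c is closed and c decreases to 1, so for each z the indicator is
    eventually constant; the Gaussian density dominates. *)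
Lemma cvg_crossing_mass dl T (x : vec R n) :
  crossing_mass dl T ((1 + k.+1%:R^-1) ^+ 2)%R x @[k --> \oo] -->
  crossing_mass dl T 1%R x.
Proof.
pose f k z := (crossing dl T ((1 + k.+1%:R^-1) ^+ 2)%R x z * gauss_density z)%:E.
have [//|||||_ _] := @dominated_convergence _ _ _ vol _ measurableT f
  (fun z => (crossing dl T 1%R x z * gauss_density z)%:E)
  (EFin \o @gauss_density R n).
- by move=> k; exact: measurable_crossing_density.
- exact: measurable_crossing_density.
- apply: aeW => z _; rewrite /f.
  have [vd|vd] := leP (vquad (dot x z) (dot z z) dl) 1%R.
    rewrite (_ : (fun k => _) = cst (crossing dl T 1%R x z * gauss_density z)%:E).
      exact: cvg_cst.
    apply/funext => k; rewrite /crossing vd (le_trans vd)// -[X in (X <=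
      _)%R](expr1n _ 2).
    by rewrite lerXn2r ?nnegrE// ?addr_ge0 ?invr_ge0// lerDl invr_ge0.
  apply: cvg_near_cst.
  have cc : (((1 + k.+1%:R^-1) ^+ 2)%R @[k --> \oo] --> (1 : R)%R).
    have c1 : ((1 + k.+1%:R^-1)%R @[k --> \oo] --> (1 : R)%R).
      rewrite -[X in _ --> X]addr0.
      by apply: cvgD; [exact: cvg_cst|exact: cvg_harmonic].
    by have := cvgM c1 c1; rewrite mulr1; exact.
  have : \forall k \near \oo, ((1 + k.+1%:R^-1) ^+ 2 < vquad (dot x z) (dot z z) dl)%R.
    exact: (cvgr_lt _ cc).
  apply: filterS => k ck; rewrite /crossing (leNgt _ 1%R) vd leNgt ck//.
- apply/integrableP; split; first exact: measurable_gauss_density.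
  rewrite (eq_integral (EFin \o @gauss_density R n)).
    by rewrite integral_gauss_density ltry.
  by move=> z _; rewrite gee0_abs// lee_fin gauss_density_ge0.
- apply: aeW => z k _; rewrite gee0_abs ?crossing_density_ge0//.
  exact: crossing_density_le.
exact.
Qed.

Lemma time_kernel_mass (dl T : R) (x : vec R n) : (0 < dl)%R -> (dl <= T)%R ->
  (1 <= T)%R -> sphere x ->
  \int[@surface R n]_y time_kernel dl T x y <= (2^-1 - (stability_constant (n := n)
    T)^-1)%:E.
Proof.
move=> dl0 dlT T1 xS; have T0 : (0 < T)%R by exact: lt_le_trans T1.
set H := \int[_]_y _.
have HI : H <= crossing_mass dl T 1%R x.
  have Hfin : H \is a fin_num.
    rewrite ge0_fin_numE; first exact: integral_time_kernel_lty.
    by apply: integral_ge0 => y _; exact: time_kernel_ge0.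
  rewrite -(fineK Hfin) -(fineK (crossing_mass_fin dl T 1%R x)) lee_fin.
  (* [shell_bound] is used with e = 1/(k+1); both prefactors tend to 1. *)
  have ce : ((k.+1%:R^-1)%R @[k --> \oo] --> (0 : R)%R) := cvg_harmonic.
  have cI : fine (crossing_mass dl T ((1 + k.+1%:R^-1) ^+ 2)%R x) @[k --> \oo] -->
      fine (crossing_mass dl T 1%R x).
    by apply: fine_cvg; rewrite fineK ?crossing_mass_fin//; exact: cvg_crossing_mass.
  have c2 : ((1 + k.+1%:R^-1 / 2) * fine (crossing_mass dl T ((1 + k.+1%:R^-1) ^+
    2)%R x)
      @[k --> \oo] --> fine (crossing_mass dl T 1%R x))%R.
    rewrite -[X in _ --> X]mul1r; apply: cvgM; last exact: cI.
    rewrite -[X in _ --> X]addr0; apply: cvgD; first exact: cvg_cst.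
    by rewrite -[X in _ --> X](mul0r (2^-1)%R); apply: cvgM => //; exact: cvg_cst.
  have c1 : (expR (- (5 * k.+1%:R^-1 / (4 * dl))) * fine H @[k --> \oo] --> fine H)%R.
    rewrite -[X in _ --> X]mul1r; apply: cvgM; last exact: cvg_cst.
    rewrite -[X in _ --> X]expR0.
    apply: (@cvg_comp _ _ _ (fun k => - (5 * k.+1%:R^-1 / (4 * dl)))%R expR); last
      first.
      exact: continuous_expR.
    rewrite -oppr0; apply: cvgN.
    have := cvgM (cvgM (cvg_cst (5%R : R)) ce) (cvg_cst ((4 * dl)^-1)%R).
    by rewrite mulr0 mul0r; exact.
  apply: (ler_cvg_to c1 c2); apply: nearW => k.
  have := @shell_bound dl T (k.+1%:R^-1)%R x dl0 dlT _ xS.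
  rewrite invr_gt0 ltr0n/= invf_le1 ?ltr0n// ler1n => /(_ isT).
  by rewrite -/H -(fineK Hfin) -(fineK (crossing_mass_fin _ _ _ _)) -!EFinM lee_fin.
have md : measurable_fun setT (fun z : vec R n => dot z z) by exact: measurable_fun_dot.
have mx : measurable_fun setT (fun z : vec R n => dot x z) by exact: measurable_fun_dot.
have mg := @measurable_fun_gauss_density R n _ _ _ (@measurable_id _ (vec R n) setT).
have mT : measurable_fun setT (fun z : vec R n =>
    ((vquad (dot x z) (dot z z) T <= 1)%R%:R * gauss_density z)%:E).
  apply/measurable_EFinP; apply: measurable_funM => //.
  by apply: measurable_ler_indic => //; exact: measurable_fun_vquad.
have gT z : 0 <= ((vquad (dot x z) (dot z z) T <= 1)%R%:R * gauss_density z)%:E.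
  by rewrite lee_fin mulr_ge0 ?gauss_density_ge0.
have m1 : measurable_fun setT (fun z : vec R n => ((dot x z < 0)%R%:R *
  gauss_density z)%:E).
  by apply/measurable_EFinP; apply: measurable_funM => //; exact: measurable_ltr_indic.
have m2 : measurable_fun setT (fun z : vec R n => ((dot z z <= 0)%R%:R *
  gauss_density z)%:E).
  by apply/measurable_EFinP; apply: measurable_funM => //; exact: measurable_ler_indic.
have g1 z : 0 <= ((dot x z < 0)%R%:R * gauss_density z)%:E.
  by rewrite lee_fin mulr_ge0 ?gauss_density_ge0.
have g2 (z : vec R n) : 0 <= ((dot z z <= 0)%R%:R * gauss_density z)%:E.
  by rewrite lee_fin mulr_ge0 ?gauss_density_ge0.
(* Being in the ball at time t means 2 sqrt t x.z + t |z|^2 <= 0. *)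
have inward (z : vec R n) t : (0 < t)%R -> (vquad (dot x z) (dot z z) t <= 1)%R ->
    (dot x z < 0)%R \/ (dot z z <= 0)%R.
  move=> t0; rewrite /vquad; case: (ltP (dot x z) 0%R) => [|xz]; first by left.
  case: (leP (dot z z) 0%R) => [|zz]; first by right.
  have st : (0 < Num.sqrt t)%R by rewrite sqrtr_gt0.
  have h1 : (0 < t * dot z z)%R by rewrite mulr_gt0.
  have h2 : (0 <= Num.sqrt t * dot x z)%R by rewrite mulr_ge0// ltW.
  lra.
have sum : crossing_mass dl T 1%R x +
    \int[vol]_z ((vquad (dot x z) (dot z z) T <= 1)%R%:R * gauss_density z)%:E <=
    (2^-1)%:E.
  (* The null mass of the origin is added on the right, so that the indicators compare at every z,
     including z = 0. *)
  rewrite -[X in _ <= X]adde0 -[X in _ <= _ + X](gauss_origin n0).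
  apply: (@le_trans _ _ (\int[vol]_z ((dot x z < 0)%R%:R * gauss_density z)%:E +
     \int[vol]_z ((dot z z <= 0)%R%:R * gauss_density z)%:E)); last first.
    by rewrite leeD2r// gauss_half_space.
  rewrite -!ge0_integralD//; [|by move=> z _; exact: crossing_density_ge0
    |exact: measurable_crossing_density].
  apply: ge0_le_integral => //.
  - by move=> z _; rewrite adde_ge0// crossing_density_ge0.
  - by apply: emeasurable_funD => //; exact: measurable_crossing_density.
  - exact: emeasurable_funD.
  move=> z _; rewrite -!EFinD lee_fin -!mulrDl ler_wpM2r ?gauss_density_ge0//.
  rewrite /crossing; case: (leP (vquad _ _ T) 1%R) => vT.
    rewrite mulr0 add0r; case: (inward z T T0 vT) => ->;
      by rewrite -natrD ler_nat ?leq_addr ?leq_addl.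
  rewrite mulr1 addr0; case: (boolP (vquad _ _ dl <= 1)%R) => vd; last by rewrite
    addr_ge0.
  by case: (inward z dl dl0 vd) => ->; rewrite -natrD ler_nat ?leq_addr ?leq_addl.
have ball := gauss_ball_mass n0 xS T1.
rewrite EFinB leeBrDr//; apply: le_trans sum; exact: leeD.
Qed.

End kernel_mass.

(** * The kernel down to time 0, cut into time steps *)

Section slabs.
Context {R : realType} {n : nat}.
Hypothesis n0 : (0 < n)%N.
Local Open Scope ereal_scope.
Local Notation mu := (@lebesgue_measure R).

Definition kernel_mass (x : vec R n) (t : R) : \bar R :=
  \int[@surface R n]_y (sphere_kernel x y t)%:E.

Lemma kernel_mass_ge0 x t : 0 <= kernel_mass x t.
Proof. by apply: integral_ge0 => y _; rewrite lee_fin sphere_kernel_ge0. Qed.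

Lemma measurable_kernel_mass x (D : set (measurableTypeR R)) :
  measurable_fun D (kernel_mass x).
Proof.
apply: measurable_funTS.
apply: (@measurable_fun_fubini_tonelli_F _ _ _ _ _ (@surface R n)
  (fun p : measurableTypeR R * vec R n => (sphere_kernel x p.2 p.1)%:E)).
  by apply/measurable_EFinP; exact: measurable_sphere_kernel.
by move=> p; rewrite lee_fin sphere_kernel_ge0.
Qed.

Lemma integral_time_kernelE (a b : R) (x : vec R n) :
  \int[@surface R n]_y time_kernel a b x y =
  \int[mu]_(t in `[a, b]) kernel_mass x t.
Proof.
rewrite (@fubini_tonelli _ _ _ _ _ (@surface R n) mu
  (fun p : vec R n * measurableTypeR R => (truncated_kernel a b x p.1 p.2)%:E));
    last 2 first.
- by apply/measurable_EFinP; exact: measurable_truncated_kernel.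
- by move=> p; rewrite lee_fin truncated_kernel_ge0.
rewrite [RHS]integral_mkcond; apply: eq_integral => t _; rewrite patchE.
case: ifPn; rewrite /truncated_kernel/=.
  rewrite inE/= in_itv/= => ->; apply: eq_integral => y _.
  by rewrite mul1r.
rewrite notin_setE/= in_itv/= => /negP/negbTE ->.
by apply: integral0_eq => y _; rewrite mul0r.
Qed.

(** The bound of [time_kernel_mass] does not depend on the lower cut-off, which tends to 0 along
    T/(k+2) by monotone convergence. *)
Lemma kernel_mass_le (T : R) (x : vec R n) : (1 <= T)%R -> sphere x ->
  \int[mu]_(t in `]0%R, T]) kernel_mass x t <=
  (2^-1 - (stability_constant (n := n) T)^-1)%:E.
Proof.
move=> T1 xS; have T0 : (0 < T)%R by exact: lt_le_trans T1.
have cv := cvg_integral_itv_oc T0 (@measurable_kernel_mass x) (kernel_mass_ge0 x).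
rewrite -(cvg_lim _ cv)//; apply: lime_le; first by apply/cvg_ex; eexists; exact: cv.
apply: nearW => k; rewrite -integral_time_kernelE; apply: time_kernel_mass => //.
  by rewrite divr_gt0.
by rewrite ler_pdivrMr// ler_peMr ?(ltW T0)// ler1n.
Qed.

Variable dt : R.
Hypothesis dt0 : (0 < dt)%R.

(** In step j, the elapsed time j dt - tau for tau in the k-th time interval fills slab i = j - k -
    1, so this slab weights [sigma k]. *)
Definition slab_kernel (i : nat) : vec R n -> vec R n -> \bar R :=
  time_kernel (i%:R * dt) (i.+1%:R * dt).

Lemma slab_kernel_ge0 i x y : 0 <= slab_kernel i x y.
Proof. exact: time_kernel_ge0. Qed.

Lemma slab_kernelC i x y : slab_kernel i x y = slab_kernel i y x.
Proof.
by apply: eq_integral => t _; rewrite /truncated_kernel sphere_kernelC.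
Qed.

Lemma measurable_slab_kernel2 i :
  measurable_fun setT (fun p : vec R n * vec R n => slab_kernel i p.1 p.2).
Proof.
apply: (@measurable_fun_fubini_tonelli_F _ _ _ _ _ mu
  (fun p : (vec R n * vec R n) * measurableTypeR R =>
    (truncated_kernel (i%:R * dt) (i.+1%:R * dt) p.1.1 p.1.2 p.2)%:E)).
  apply/measurable_EFinP; apply: measurable_truncated_kernel => //.
    exact: (measurableT_comp (@measurable_fst _ _ _ _) (@measurable_fst _ _ _ _)).
  exact: (measurableT_comp (@measurable_snd _ _ _ _) (@measurable_fst _ _ _ _)).
by move=> p; rewrite lee_fin truncated_kernel_ge0.
Qed.

Lemma measurable_slab_kernel i x : measurable_fun setT (slab_kernel i x).
Proof. exact: measurable_time_kernel. Qed.

Lemma sum_slab_kernel_mass (N : nat) (x : vec R n) :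
  \sum_(i < N) \int[@surface R n]_y slab_kernel i x y =
  \int[mu]_(t in `]0%R, (N%:R * dt)%R]) kernel_mass x t.
Proof.
elim: N => [|N IH].
  by rewrite big_ord0 mul0r set_itvoc0 integral_set0.
have N0 : (0 <= N%:R * dt)%R by rewrite mulr_ge0 ?(ltW dt0).
have N1 : (N%:R * dt <= N.+1%:R * dt)%R by rewrite ler_wpM2r ?(ltW dt0)// ler_nat.
rewrite big_ord_recr/= IH integral_time_kernelE.
rewrite -(integral_itv_obnd_cbnd (b := BRight _)); last exact: measurable_kernel_mass.
rewrite -ge0_integral_setU//.
- congr integral; apply/seteqP; split => t /=; rewrite !in_itv/=.
    by case=> /andP[t0 t1]; rewrite ?t0 ?t1 ?(le_trans t1)// (le_lt_trans N0).
  by move=> /andP[t0 t1]; case: (leP t (N%:R * dt)%R) => tN; [left|right]; rewrite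
    ?t0 ?tN ?t1.
- exact: measurable_kernel_mass.
- by move=> t _; exact: kernel_mass_ge0.
- rewrite disj_set2E; apply/eqP; rewrite -subset0 => t /= []; rewrite !in_itv/=.
  by move=> /andP[_ tN] /andP[]; rewrite ltNge tN.
Qed.

Lemma slab_mass_le (N : nat) (T : R) (x : vec R n) : (1 <= T)%R -> sphere x ->
  (N%:R * dt <= T)%R ->
  \sum_(i < N) \int[@surface R n]_y slab_kernel i x y <=
  (2^-1 - (stability_constant (n := n) T)^-1)%:E.
Proof.
move=> T1 xS NT; rewrite sum_slab_kernel_mass.
apply: le_trans (kernel_mass_le T1 xS); apply: ge0_subset_integral => //.
- exact: measurable_kernel_mass.
- by move=> t _; exact: kernel_mass_ge0.
- by move=> t /=; rewrite !in_itv/= => /andP[-> /le_trans]; apply.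
Qed.

End slabs.

(** * Integral inequalities without measurability *)

Section nonmeasurable.
Context d (T : measurableType d) (R : realType) (m : {measure set T -> \bar R}).
Local Open Scope ereal_scope.

(* The integral of a nonnegative function, measurable or not, is the supremum of
   the integrals of the simple functions below it. *)
Lemma ge0_le_integral_sup (D : set T) (f g : T -> \bar R) :
  (forall x, D x -> 0 <= f x) -> (forall x, D x -> f x <= g x) ->
  \int[m]_(x in D) f x <= \int[m]_(x in D) g x.
Proof.
move=> f0 fg; rewrite !ge0_integralE//; last first.
  by move=> x Dx; exact: le_trans (f0 x Dx) (fg x Dx).
apply: le_ereal_sup => _ [h /= hf <-]; exists h => // x.
apply: (le_trans (hf x)); rewrite !patchE; case: ifPn => //.
by rewrite inE => /fg.
Qed.

(** If the right-hand side is infinite there is nothing to prove; otherwise it bounds the integrals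
    of both parts of f, and two numbers in [0, M] differ by at most M. Thus the iterated integrals
    of the scheme can be estimated before their integrands are known to be measurable. *)
Lemma normr_Rintegral_le (D : set T) (f : T -> R) :
  (`|\int[m]_(x in D) f x|%R)%:E <= \int[m]_(x in D) (`|f x|%R)%:E.
Proof.
have pos0 : 0 <= \int[m]_(x in D) ((EFin \o f)^\+ x) by exact: integral_ge0.
have neg0 : 0 <= \int[m]_(x in D) ((EFin \o f)^\- x) by exact: integral_ge0.
have posle : \int[m]_(x in D) ((EFin \o f)^\+ x) <= \int[m]_(x in D) (`|f x|%R)%:E.
  apply: ge0_le_integral_sup => // x _.
  by rewrite funeposE/= -EFin_max lee_fin ge_max ler_norm normr_ge0.
have negle : \int[m]_(x in D) ((EFin \o f)^\- x) <= \int[m]_(x in D) (`|f x|%R)%:E.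
  apply: ge0_le_integral_sup => // x _.
  by rewrite funenegE/= -EFin_max lee_fin ge_max -normrN ler_norm normr_ge0.
rewrite /Rintegral integralE; move: posle negle pos0 neg0.
case: (\int[m]_(x in D) (`|f x|%R)%:E) => [M||]; last first.
- by case: (integral _ _ _).
- by move=> *; rewrite leey.
case: (\int[m]_(x in D) ((EFin \o f)^\+ x)) => [a||]//.
case: (\int[m]_(x in D) ((EFin \o f)^\- x)) => [b||]//=.
rewrite !lee_fin => aM bM a0 b0; rewrite ler_norml; apply/andP; split; lra.
Qed.

End nonmeasurable.

(** * The terms of the scheme bounded by slab kernels *)

Section scheme.
Context {R : realType} {n : nat}.
Local Open Scope ereal_scope.
Local Notation mu := (@lebesgue_measure R).
Local Notation S := (@surface R n).
Variable dt : R.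
Hypothesis dt0 : (0 < dt)%R.

Lemma integral_slab_kernel_time (i : nat) (x : vec R n) (s : vec R n -> R) :
  measurable_fun setT s -> (forall y, 0 <= s y)%R ->
  \int[S]_y (slab_kernel dt i x y * (s y)%:E) =
  \int[mu]_t \int[S]_y
     (truncated_kernel (i%:R * dt) (i.+1%:R * dt) x y t * s y)%:E.
Proof.
move=> ms s0.
rewrite -(@fubini_tonelli _ _ _ _ _ S mu
  (fun p : vec R n * measurableTypeR R =>
     (truncated_kernel (i%:R * dt) (i.+1%:R * dt) x p.1 p.2 * s p.1)%:E)); last 2 first.
- apply/measurable_EFinP; apply: measurable_funM; first exact:
  measurable_truncated_kernel.
  exact: (measurableT_comp ms (@measurable_fst _ _ _ _)).
- by move=> p; rewrite lee_fin mulr_ge0// truncated_kernel_ge0.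
apply: eq_integral => y _; rewrite /slab_kernel /time_kernel muleC.
rewrite -ge0_integralZl_EFin//.
- by apply: eq_integral => t _; rewrite -EFinM mulrC.
- by move=> t _; rewrite lee_fin truncated_kernel_ge0.
- by apply/measurable_EFinP; exact: measurable_truncated_kernel.
Qed.

Lemma integral_point_infty (D : set (measurableTypeR R)) (a : R) : measurable D ->
  \int[mu]_(t in D) (+oo * (\1_[set a] t)%:E) = 0.
Proof.
move=> mD; have ma : measurable ([set a] : set (measurableTypeR R)) by exact:
  measurable_set1.
rewrite ge0_integralZl//; last first.
  by apply: measurable_funTS; apply/measurable_EFinP; exact: measurable_indic.
rewrite integral_indic// [X in _ * X](_ : _ = 0) ?mule0//.
apply: (@subset_measure0 _ _ _ (@lebesgue_measure R) _ [set a]) => //; first exact: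
  measurableI.
exact: lebesgue_measure_set1.
Qed.

(** The absolute value is moved inside both integrals, where the normal derivative becomes the
    nonnegative [sphere_kernel]; reflecting time by t = j dt - tau then yields slab j - k - 1. *)
Lemma scheme_term_le (j k : nat) (x : vec R n) (s : vec R n -> R) :
  (k < j)%N -> sphere x -> measurable_fun setT s ->
  (`| \int[mu]_(tau in `[k%:R * dt, k.+1%:R * dt])
        \int[surface_measure n]_(y in sphere)
          (heat_kernel_dnu x y (j%:R * dt - tau) * s y) |%R)%:E <=
  \int[S]_y (slab_kernel dt (j - k.+1) x y * (`|s y|%R)%:E).
Proof.
move=> kj xS ms; apply: le_trans (normr_Rintegral_le _ _ _) _.
have mns : measurable_fun setT (fun y => `|s y|%R) by exact: measurableT_comp.
pose U (tau : R) := \int[S]_y (sphere_kernel x y (j%:R * dt - tau)%R * `|s y|%R)%:E.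
have mU : measurable_fun setT (U : measurableTypeR R -> \bar R).
  apply: (@measurable_fun_fubini_tonelli_F _ _ _ _ _ S
    (fun p : measurableTypeR R * vec R n =>
      (sphere_kernel x p.2 (j%:R * dt - p.1)%R * `|s p.2|%R)%:E)).
    apply/measurable_EFinP; apply: measurable_funM.
      by apply: measurable_sphere_kernel => //; exact: measurable_funB.
    exact: (measurableT_comp mns (@measurable_snd _ _ _ _)).
  by move=> p; rewrite lee_fin mulr_ge0// sphere_kernel_ge0.
have U0 tau : 0 <= U tau.
  by apply: integral_ge0 => y _; rewrite lee_fin mulr_ge0// sphere_kernel_ge0.
have mI : measurable (`[(k%:R * dt)%R, (k.+1%:R * dt)%R] : set (measurableTypeR R)).
  exact: measurable_itv.
(* At tau = j dt, where the kernel has its singular time, use the bound +oo. *)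
apply: (@le_trans _ _ (\int[mu]_(tau in `[(k%:R * dt)%R, (k.+1%:R * dt)%R])
    (U tau + +oo * (\1_[set (j%:R * dt)%R] tau)%:E))).
  apply: ge0_le_integral_sup => tau; rewrite /= in_itv/= => /andP[_ tk].
    by rewrite lee_fin.
  have [->|tj] := eqVneq tau (j%:R * dt)%R.
    by rewrite indicE mem_set// mule1 addey ?leey// gt_eqF// (lt_le_trans _ (U0 _)).
  rewrite indicE memNset ?mule0 ?adde0; last by move=> /= /eqP; rewrite (negbTE tj).
  have tau0 : (0 < j%:R * dt - tau)%R.
    rewrite subr_gt0 lt_neqAle tj (le_trans tk)//.
    by rewrite ler_wpM2r ?(ltW dt0)// ler_nat.
  apply: le_trans (normr_Rintegral_le _ _ _) _.
  rewrite integral_surface_measureE /U -ge0_integral_sphere.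
  - rewrite le_eqVlt; apply/orP; left; apply/eqP; apply: eq_integral => y.
    rewrite inE => yS; rewrite heat_kernel_dnu_sphere// mulNr normrN normrM.
    by rewrite ger0_norm ?sphere_kernel_ge0.
  - apply/measurable_EFinP; apply: measurable_funM => //.
    exact: measurable_sphere_kernel.
  - by move=> y; rewrite lee_fin mulr_ge0// sphere_kernel_ge0.
rewrite ge0_integralD//; last 2 first.
- exact: measurable_funTS.
- apply: measurable_funeM; apply: measurable_funTS.
  by apply/measurable_EFinP; exact: measurable_indic.
rewrite integral_point_infty// adde0 integral_slab_kernel_time//.
set f := fun t => \int[S]_y _.
have mf : measurable_fun setT (f : measurableTypeR R -> \bar R).
  apply: (@measurable_fun_fubini_tonelli_F _ _ _ _ _ S
    (fun p : measurableTypeR R * vec R n =>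
      (truncated_kernel ((j - k.+1)%N%:R * dt) ((j - k.+1).+1%:R * dt) x p.2 p.1
         * `|s p.2|%R)%:E)).
    apply/measurable_EFinP; apply: measurable_funM.
      by apply: measurable_truncated_kernel.
    exact: (measurableT_comp mns (@measurable_snd _ _ _ _)).
  by move=> p; rewrite lee_fin mulr_ge0// truncated_kernel_ge0.
have f0 t : 0 <= f t.
  by apply: integral_ge0 => y _; rewrite lee_fin mulr_ge0// truncated_kernel_ge0.
rewrite -[leRHS](@ge0_integral_affine _ (j%:R * dt)%R (-1)%R)//.
rewrite normrN1 mul1e integral_mkcond le_eqVlt; apply/orP; left; apply/eqP.
apply: eq_integral => tau _; rewrite patchE /f /U mulN1r.
have E : ((j - k.+1)%N%:R * dt <= j%:R * dt - tau <= (j - k.+1).+1%:R * dt)%R =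
         (k%:R * dt <= tau <= k.+1%:R * dt)%R.
  rewrite -subSn// subSS !natrB ?(ltnW kj)//.
  by apply/idP/idP => /andP[? ?]; apply/andP; split; lra.
case: ifPn; rewrite /truncated_kernel.
  rewrite inE/= in_itv/= => tk; apply: eq_integral => y _.
  by rewrite E tk mul1r.
rewrite notin_setE/= in_itv/= => /negP/negbTE tk.
by apply/esym/integral0_eq => y _; rewrite E tk !mul0r.
Qed.

End scheme.

(** * The pointwise form of the Schur test *)

Section schur.
Context {R : realType}.
Local Open Scope ereal_scope.

(** Multiply the hypothesis by 2s. Young's inequality 2 s f <= s^2 + f^2 under the kernel gives 2 s
    I <= s^2 (1/2 - m) + Q, and 2 s G <= m s^2 + G^2/m. The terms in m cancel, s^2/2 remains to be
    absorbed, and doubling gives the constants 2/m and 2. *)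
Lemma schur_pointwise d (Y : measurableType d) (nu : {measure set Y -> \bar R})
    (j : nat) (K : nat -> Y -> \bar R) (f : nat -> Y -> R) (s G m : R) :
  (forall k, measurable_fun setT (K k)) -> (forall k y, 0 <= K k y) ->
  (forall k, (k < j)%N -> measurable_fun setT (f k)) -> (forall k y, (0 <= f k y)%R) ->
  (0 <= s)%R -> (0 < m)%R ->
  \sum_(k < j) \int[nu]_y K k y <= (2^-1 - m)%:E ->
  (2^-1 * s)%:E <= G%:E + \sum_(k < j) \int[nu]_y (K k y * (f k y)%:E) ->
  (s ^+ 2)%:E <= (2 / m * G ^+ 2)%:E +
    2%:E * \sum_(k < j) \int[nu]_y (K k y * (f k y ^+ 2)%:E).
Proof.
move=> mK K0 mf f0 s0 m0.
set M := \sum_(k < j) \int[nu]_y K k y.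
set I := \sum_(k < j) \int[nu]_y (K k y * (f k y)%:E).
set Q := \sum_(k < j) \int[nu]_y (K k y * (f k y ^+ 2)%:E) => Mm sI.
have Kf0 k y : 0 <= K k y * (f k y)%:E by rewrite mule_ge0// lee_fin.
have Kf20 k y : 0 <= K k y * (f k y ^+ 2)%:E by rewrite mule_ge0// lee_fin sqr_ge0.
have M0 : 0 <= M by apply: sume_ge0 => k _; exact: integral_ge0.
have I0 : 0 <= I by apply: sume_ge0 => k _; exact: integral_ge0.
have Q0 : 0 <= Q by apply: sume_ge0 => k _; exact: integral_ge0.
have young : (2 * s)%:E * I <= (s ^+ 2)%:E * M + Q.
  rewrite /I /M /Q ge0_sume_distrr; last by move=> k _; exact: integral_ge0.
  rewrite ge0_sume_distrr; last by move=> k _; exact: integral_ge0.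
  rewrite -big_split/=; apply: lee_sum => k _.
  have mfk := mf k (ltn_ord k).
  have mKf : measurable_fun setT (fun y => K k y * (f k y)%:E).
    by apply: emeasurable_funM => //; exact/measurable_EFinP.
  have mKf2 : measurable_fun setT (fun y => K k y * (f k y ^+ 2)%:E).
    apply: emeasurable_funM => //; apply/measurable_EFinP.
    exact: measurable_funX.
  rewrite -ge0_integralZl_EFin ?mulr_ge0//.
  rewrite -ge0_integralZl_EFin ?sqr_ge0//.
  rewrite -ge0_integralD//; last 2 first.
  - by move=> y _; rewrite mule_ge0// lee_fin sqr_ge0.
  - exact: measurable_funeM.
  apply: ge0_le_integral => //.
  - by move=> y _; rewrite mule_ge0// lee_fin mulr_ge0.
  - exact: measurable_funeM.
  - by apply: emeasurable_funD => //; exact: measurable_funeM.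
  move=> y _; rewrite muleCA [X in _ <= X + _]muleC -ge0_muleDr ?lee_fin ?sqr_ge0//.
  apply: lee_wpmul2l => //; rewrite -EFinM -EFinD lee_fin.
  by have := sqr_ge0 (s - f k y); nra.
(* Infinite values come first: Q = +oo makes the claim trivial, and for finite Q and s > 0 the bound
   [young] forces I to be finite. *)
move: sI young Mm M0 I0 Q0; case: Q => [q||]//; last first.
  by move=> *; rewrite gt0_muley ?lte_fin// addey ?leey.
case: M => [M||]//; have [->|s1] := eqVneq s 0%R.
  move=> _ _ _ _ _ q0; rewrite expr0n/= -EFinM -EFinD lee_fin addr_ge0//.
    by rewrite mulr_ge0 ?sqr_ge0// divr_ge0// ltW.
  by rewrite mulr_ge0.
have sp : (0 < s)%R by rewrite lt_neqAle eq_sym s1.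
case: I => [I||]//; last by rewrite gt0_muley ?lte_fin ?mulr_gt0.
rewrite -!EFinM -!EFinD !lee_fin => sI young Mm M0 I0 q0.
have sq : (0 <= (m * s - G) ^+ 2 / m)%R by rewrite divr_ge0 ?sqr_ge0// ltW.
have E : ((m * s - G) ^+ 2 / m = m * s ^+ 2 - 2 * (s * G) + 2 / m * G ^+ 2 / 2)%R.
  by field; rewrite gt_eqF.
have h1 : (s * s <= 2 * (s * G) + 2 * s * I)%R by nra.
have h2 : (s ^+ 2 * M <= s ^+ 2 * (2^-1 - m))%R by rewrite ler_wpM2l ?sqr_ge0.
move: sq; rewrite E; move: (2 / m * G ^+ 2)%R => W; rewrite expr2 in h2 young *; nra.
Qed.

End schur.

(** * Summation over the time steps and absorption *)

Section energy.
Context {R : realType} {n : nat}.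
Local Open Scope ereal_scope.
Local Notation nu := (@surface R n).
Variables (T dt : R) (N : nat) (g sigma : nat -> vec R n -> R).
Hypotheses (n0 : (0 < n)%N) (T1 : (1 <= T)%R) (dt0 : (0 < dt)%R).
Hypothesis NT : (N%:R * dt <= T)%R.
Hypothesis mg : forall j, (j <= N)%N -> measurable_fun setT (g j).
Hypothesis Hsigma : forward_euler_solution dt N g sigma.

Let m : R := ((stability_constant (n := n) T)^-1)%R.

Let m0 : (0 < m)%R.
Proof. by rewrite invr_gt0 stability_constant_gt0// (lt_le_trans _ T1). Qed.

Let msigma j : (j <= N)%N -> measurable_fun setT (sigma j).
Proof. by move=> /Hsigma []. Qed.

Definition energy (f : vec R n -> R) : \bar R := \int[nu]_x (f x ^+ 2)%:E.

Lemma energy_ge0 f : 0 <= energy f.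
Proof. by apply: integral_ge0 => x _; rewrite lee_fin sqr_ge0. Qed.

Definition slab_energy (i k : nat) : \bar R :=
  \int[nu]_x \int[nu]_y (slab_kernel dt i x y * (sigma k y ^+ 2)%:E).

Lemma slab_energy_ge0 i k : 0 <= slab_energy i k.
Proof.
apply: integral_ge0 => x _; apply: integral_ge0 => y _.
by rewrite mule_ge0 ?slab_kernel_ge0// lee_fin sqr_ge0.
Qed.

Let mslab2 i k : (k <= N)%N -> measurable_fun setT
  (fun p : vec R n * vec R n => slab_kernel dt i p.1 p.2 * (sigma k p.2 ^+ 2)%:E).
Proof.
move=> kN; apply: emeasurable_funM; first exact: measurable_slab_kernel2.
apply/measurable_EFinP; apply: measurable_funX.
exact: (measurableT_comp (msigma kN) (@measurable_snd _ _ _ _)).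
Qed.

Let slab20 i k (p : vec R n * vec R n) :
  0 <= slab_kernel dt i p.1 p.2 * (sigma k p.2 ^+ 2)%:E.
Proof. by rewrite mule_ge0 ?slab_kernel_ge0// lee_fin sqr_ge0. Qed.

Let mmass i : measurable_fun setT (fun y => \int[nu]_x slab_kernel dt i y x).
Proof.
apply: (@measurable_fun_fubini_tonelli_F _ _ _ _ _ nu
  (fun p : vec R n * vec R n => slab_kernel dt i p.1 p.2)).
  exact: measurable_slab_kernel2.
by move=> p; exact: slab_kernel_ge0.
Qed.

(* The kernel is symmetric, so the row bound is also the column bound. *)
Lemma sum_slab_energy_le (M k : nat) : (M <= N)%N -> (k <= N)%N ->
  \sum_(i < M) slab_energy i k <= (2^-1 - m)%:E * energy (sigma k).
Proof.
move=> MN kN; have ms2 : measurable_fun setT (fun y => (sigma k y ^+ 2)%:E).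
  by apply/measurable_EFinP; apply: measurable_funX; exact: msigma.
have E i : slab_energy i k =
    \int[nu]_y ((sigma k y ^+ 2)%:E * \int[nu]_x slab_kernel dt i y x).
  rewrite /slab_energy (@fubini_tonelli _ _ _ _ _ nu nu
    (fun p : vec R n * vec R n => slab_kernel dt i p.1 p.2 * (sigma k p.2 ^+ 2)%:E))//;
    last exact: mslab2.
  apply: eq_integral => y _; rewrite -ge0_integralZl_EFin ?sqr_ge0//.
  - by apply: eq_integral => x _; rewrite muleC slab_kernelC.
  - by move=> x _; exact: slab_kernel_ge0.
  - exact: measurable_slab_kernel.
under eq_bigr do rewrite E.
rewrite -ge0_integral_sum//; last 2 first.
- by move=> i; exact: emeasurable_funM.
- by move=> i y _; rewrite mule_ge0 ?lee_fin ?sqr_ge0// integral_ge0// => x _;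
    exact: slab_kernel_ge0.
(* The sign is read off the kernel bound itself, at the first basis vector as a point of the
   sphere. *)
have b0 : (0 <= 2^-1 - m)%R.
  pose e : vec R n := [tuple ((i : nat) == 0%N)%:R%R | i < n].
  have eS : sphere e.
    rewrite /sphere/= /enorm /dot (bigD1 (Ordinal n0))//= tnth_mktuple eqxx mulr1.
    rewrite big1 ?addr0 ?sqrtr1// => i; rewrite -val_eqE/= => i0.
    by rewrite tnth_mktuple (negbTE i0) mulr0.
  rewrite -lee_fin; apply: le_trans (kernel_mass_le n0 T1 eS).
  by apply: integral_ge0 => t _; exact: kernel_mass_ge0.
rewrite /energy -ge0_integralZl_EFin//; last by move=> y _; rewrite lee_fin sqr_ge0.
rewrite -[leRHS]ge0_integral_sphere; last 2 first.
- exact: measurable_funeM.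
- by move=> y; rewrite mule_ge0 ?lee_fin ?sqr_ge0.
rewrite -[leLHS]ge0_integral_sphere; last 2 first.
- by apply: emeasurable_sum => i; exact: emeasurable_funM.
- move=> y; apply: sume_ge0 => i _; rewrite mule_ge0 ?lee_fin ?sqr_ge0//
  integral_ge0// => x _.
  exact: slab_kernel_ge0.
apply: ge0_le_integral => //.
- exact: measurable_sphere.
- move=> y _; apply: sume_ge0 => i _; rewrite mule_ge0 ?lee_fin ?sqr_ge0//
  integral_ge0// => x _.
  exact: slab_kernel_ge0.
- by apply: measurable_funTS; apply: emeasurable_sum => i; exact: emeasurable_funM.
- by apply: measurable_funTS; exact: measurable_funeM.
move=> y yS; rewrite -ge0_sume_distrr; last first.
  by move=> i _; apply: integral_ge0 => x _; exact: slab_kernel_ge0.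
rewrite muleC; apply: lee_wpmul2r; first by rewrite lee_fin sqr_ge0.
apply: slab_mass_le => //; apply: le_trans NT.
by rewrite ler_wpM2r ?(ltW dt0)// ler_nat.
Qed.

(** The Schur inequality at almost every point of the sphere, with |sigma_j(x)| for s and |g_j(x)|
    for G, integrated in x. *)
Lemma step_energy_le (j : nat) : (j <= N)%N ->
  energy (sigma j) <= (2 / m)%:E * energy (g j) +
    2%:E * \sum_(k < j) slab_energy (j - k.+1) k.
Proof.
move=> jN; have [msj aesj] := Hsigma jN.
have mgj2 : measurable_fun setT (fun x => (g j x ^+ 2)%:E).
  by apply/measurable_EFinP; apply: measurable_funX; exact: mg.
have kN (k : 'I_j) : (k <= N)%N by rewrite (leq_trans _ jN)// ltnW.
pose r x := (2 / m * g j x ^+ 2)%:E + 2%:E * \sum_(k < j)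
  \int[nu]_y (slab_kernel dt (j - k.+1) x y * (sigma k y ^+ 2)%:E).
have sl0 (k : 'I_j) x :
    0 <= \int[nu]_y (slab_kernel dt (j - k.+1) x y * (sigma k y ^+ 2)%:E).
  by apply: integral_ge0 => y _; exact: (slab20 _ _ (x, y)).
have r0 x : 0 <= r x.
  rewrite adde_ge0//; last by rewrite mule_ge0 ?lee_fin// sume_ge0.
  by rewrite lee_fin mulr_ge0 ?sqr_ge0// divr_ge0// ltW.
have msl (k : 'I_j) : measurable_fun setT (fun x =>
    \int[nu]_y (slab_kernel dt (j - k.+1) x y * (sigma k y ^+ 2)%:E)).
  exact: (@measurable_fun_fubini_tonelli_F _ _ _ _ _ nu
    (fun p : vec R n * vec R n => slab_kernel dt (j - k.+1) p.1 p.2 * (sigma k p.2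
      ^+ 2)%:E)
    (mslab2 _ (kN k)) (slab20 _ _)).
have msum : measurable_fun setT (fun x => \sum_(k < j)
    \int[nu]_y (slab_kernel dt (j - k.+1) x y * (sigma k y ^+ 2)%:E)).
  exact: emeasurable_sum.
have mr : measurable_fun setT r.
  apply: emeasurable_funD; last exact: measurable_funeM.
  apply/measurable_EFinP; apply: measurable_funM => //.
  by apply: measurable_funX; exact: mg.
apply: (@le_trans _ _ (\int[nu]_x r x)); last first.
  rewrite le_eqVlt; apply/orP; left; apply/eqP.
  rewrite /r ge0_integralD//; last 4 first.
  - by move=> x _; rewrite lee_fin mulr_ge0 ?sqr_ge0// divr_ge0// ltW.
  - apply/measurable_EFinP; apply: measurable_funM => //.
    by apply: measurable_funX; exact: mg.
  - by move=> x _; rewrite mule_ge0 ?lee_fin// sume_ge0.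
  - exact: measurable_funeM.
  congr (_ + _).
    rewrite /energy -ge0_integralZl_EFin//.
    - by move=> x _; rewrite lee_fin sqr_ge0.
    - by rewrite divr_ge0// ltW.
  rewrite ge0_integralZl_EFin//; last by move=> x _; exact: sume_ge0.
  by rewrite ge0_integral_sum.
rewrite /energy -ge0_integral_sphere; last 2 first.
- by apply/measurable_EFinP; exact: measurable_funX.
- by move=> x; rewrite lee_fin sqr_ge0.
rewrite -[leRHS]ge0_integral_sphere//.
apply: ae_ge0_le_integral => //.
- exact: measurable_sphere.
- by move=> x _; rewrite lee_fin sqr_ge0.
- by apply: measurable_funTS; apply/measurable_EFinP; exact: measurable_funX.
- exact: measurable_funTS.
have : {ae nu, forall x, sphere x ->
      2^-1 * sigma j x +
      \sum_(k < j)
        \int[lebesgue_measure]_(tau in `[k%:R * dt, k.+1%:R * dt])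
          \int[surface_measure n]_(y in sphere)
            (heat_kernel_dnu x y (j%:R * dt - tau) * sigma k y)
      = g j x}%R.
  by case: aesj => A [mA A0 As]; exists A.
apply: filterS => x Hx xS; have {}Hx := Hx xS.
rewrite /r -[(sigma j x ^+ 2)%R]real_normK ?num_real// -[(g j x ^+ 2)%R]real_normK
  ?num_real//.
pose K k := slab_kernel dt (j - k.+1) x.
rewrite (eq_bigr (fun k : 'I_j => \int[nu]_y (K k y * (`|sigma k y|%R ^+ 2)%:E)));
  last first.
  by move=> k _; apply: eq_integral => y _; rewrite real_normK ?num_real.
apply: (@schur_pointwise _ _ _ nu j K (fun k y => `|sigma k y|%R)) => //.
- by move=> k; exact: measurable_slab_kernel.
- by move=> k y; exact: slab_kernel_ge0.
- move=> k kj; apply: measurableT_comp => //.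
  by apply: msigma; rewrite (leq_trans _ jN)// ltnW.
(* Reversing k turns the slabs j - k - 1 into 0, ..., j - 1, whose total length j dt is at most
   T. *)
- rewrite (reindex_inj rev_ord_inj)/=.
  under eq_bigr => k _.
    have -> : K (j - k.+1)%N = slab_kernel dt k x.
      by rewrite /K -subSn// subSS subKn// ltnW.
    over.
  apply: slab_mass_le => //; apply: le_trans NT.
  by rewrite ler_wpM2r ?(ltW dt0)// ler_nat.
apply: (@le_trans _ _ (`|g j x|%R%:E + \sum_(k < j) (`| \int[lebesgue_measure]_(tau
  in `[(k%:R * dt)%R, (k.+1%:R * dt)%R])
          \int[surface_measure n]_(y in sphere)
            (heat_kernel_dnu x y (j%:R * dt - tau) * sigma k y) |%R)%:E)).
  rewrite sumEFin -EFinD lee_fin.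
  rewrite -[X in (X * _ <= _)%R](@ger0_norm _ 2^-1)%R// -normrM.
  move: Hx => /(canRL (addrK _)) ->.
  by rewrite (le_trans (ler_normB _ _))// lerD2l ler_norm_sum.
apply: leeD2l; apply: lee_sum => k _.
by apply: scheme_term_le => //; exact: msigma.
Qed.

Lemma slab_energy_le (i k : nat) : (i < N)%N -> (k <= N)%N ->
  slab_energy i k <= (2^-1 - m)%:E * energy (sigma k).
Proof.
move=> iN kN; apply: le_trans (sum_slab_energy_le iN kN).
by rewrite big_ord_recr/= leeDr// sume_ge0// => l _; exact: slab_energy_ge0.
Qed.

(** Step j involves only earlier unknowns, so finiteness propagates by strong induction. The
    unknowns are only assumed measurable, and their total energy must be finite before it can be
    subtracted. *)
Lemma energy_lty : (forall j, (j <= N)%N -> energy (g j) < +oo) ->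
  forall j, (j <= N)%N -> energy (sigma j) < +oo.
Proof.
move=> gfin j; elim/ltn_ind: j => j IH jN.
apply: (le_lt_trans (step_energy_le jN)); apply: lte_add_pinfty.
  apply: lte_mul_pinfty; rewrite ?lee_fin ?divr_ge0 ?(ltW m0)//; exact: gfin.
apply: lte_mul_pinfty => //; apply: lte_sum_pinfty => k _.
have kN : (k <= N)%N by rewrite (leq_trans _ jN)// ltnW.
apply: (@le_lt_trans _ _ ((2^-1 - m)%:E * energy (sigma k))).
  apply: slab_energy_le => //; apply: leq_trans jN.
  by rewrite ltn_subrL/= (leq_ltn_trans _ (ltn_ord k)).
have /fineK <- : energy (sigma k) \is a fin_num.
  by rewrite ge0_fin_numE ?energy_ge0//; exact: IH.
by rewrite -EFinM ltry.
Qed.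

Lemma total_energy_le : (forall j, (j <= N)%N -> energy (g j) < +oo) ->
  \sum_(j < N.+1) energy (sigma j) <=
  (m^-1 ^+ 2)%:E * \sum_(j < N.+1) energy (g j).
Proof.
move=> gfin; have sfin := energy_lty gfin.
have double : \sum_(j < N.+1) \sum_(k < j) slab_energy (j - k.+1) k <=
    (2^-1 - m)%:E * \sum_(k < N.+1) energy (sigma k).
  have wide (j : 'I_N.+1) : \sum_(k < j) slab_energy (j - k.+1) k =
      \sum_(k < N.+1 | (k < j)%N) slab_energy (j - k.+1) k.
    by rewrite (big_ord_widen N.+1 (fun k => slab_energy (j - k.+1) k))// ltnW.
  under eq_bigr do rewrite wide.
  rewrite (exchange_big_dep predT)//=.
  have fin_s (k : 'I_N.+1) : energy (sigma k) \is a fin_num.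
    by rewrite ge0_fin_numE ?energy_ge0// sfin// -ltnS.
  rewrite fin_num_sume_distrr//; last by move=> i l _ _; rewrite fin_num_adde_defl.
  apply: lee_sum => k _.
  (* For fixed k, the slab index j - k - 1 runs over 0, ..., N - k - 1, which is a column sum of N -
     k slabs. *)
  rewrite -(big_mkord (fun j => k < j)%N (fun j => slab_energy (j - k.+1) k)).
  rewrite -[X in \sum_(0 <= _ < X | _) _]/(N.+1).
  rewrite big_mkord -(big_geq_mkord _ _ predT (fun j => slab_energy (j - k.+1) k)).
  rewrite -[X in \sum_(X <= _ < _) _]add0n big_addn big_mkord.
  under eq_bigr do rewrite addnK.
  by apply: sum_slab_energy_le; rewrite ?subSS ?leq_subr// -ltnS.
have : \sum_(j < N.+1) energy (sigma j) <=
    (2 / m)%:E * \sum_(j < N.+1) energy (g j) +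
    2%:E * ((2^-1 - m)%:E * \sum_(k < N.+1) energy (sigma k)).
  apply: (@le_trans _ _ (\sum_(j < N.+1) ((2 / m)%:E * energy (g j) +
     2%:E * \sum_(k < j) slab_energy (j - k.+1) k))).
    by apply: lee_sum => j _; apply: step_energy_le; rewrite -ltnS.
  rewrite big_split/= -!ge0_sume_distrr; last 2 first.
  - by move=> j _; apply: sume_ge0 => k _; exact: slab_energy_ge0.
  - by move=> j _; exact: energy_ge0.
  by apply: leeD => //; apply: lee_wpmul2l.
have : \sum_(j < N.+1) energy (sigma j) \is a fin_num.
  apply/sum_fin_numP => j _ _.
  by rewrite ge0_fin_numE ?energy_ge0// sfin// -ltnS.
have : \sum_(j < N.+1) energy (g j) \is a fin_num.
  apply/sum_fin_numP => j _ _.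
  by rewrite ge0_fin_numE ?energy_ge0// gfin// -ltnS.
move=> /fineK <- /fineK <-; rewrite -!EFinM -EFinD !lee_fin.
move: (fine _) (fine _) => Y X h.
(* Absorbing (1 - 2m) X on the left leaves 2m X <= (2/m) Y. *)
have h2 : (m * X <= m^-1 * Y)%R by move: h; rewrite -mulrA; lra.
by rewrite expr2 -mulrA ler_pdivlMl.
Qed.

End energy.

(** * From energies back to norms, and the theorem *)

Section norms.
Context {R : realType}.
Local Open Scope ereal_scope.

Lemma sqr_sqrt_poweR (A : \bar R) : 0 <= A -> (A `^ 2^-1) ^+ 2 = A.
Proof.
case: A => [r||]//; first by rewrite lee_fin => r0;
  rewrite poweR_EFin -EFin_expe powR12_sqrt// sqr_sqrtr.
by move=> _; rewrite poweRyr// expe2 mulyy.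
Qed.

Lemma Lnorm2_sqrE n (f : vec R n -> R) :
  'N[surface_measure n]_2%:E[EFin \o f] ^+ 2 = energy f.
Proof.
rewrite unlock sqr_sqrt_poweR; last by apply: integral_ge0 => x _; exact: poweR_ge0.
rewrite integral_surface_measureE; apply: eq_integral => x _.
have -> : `|(EFin \o f) x| = (`|f x|%R)%:E by [].
by rewrite poweR_EFin powR_mulrn// real_normK ?num_real.
Qed.

End norms.

Theorem mainTheorem5 (R : realType) (d : nat) (T : R)
    (hd : (1 <= d)%N) (hT : 1 <= T)
    (N : nat) (dt : R) (hN : (1 <= N)%N) (hdt : 0 < dt) (hNdt : N%:R * dt <= T)
    (g sigma : nat -> vec R d -> R)
    (hg : forall j, (j <= N)%N -> g j \in Lfun (surface_measure d) 2%:E)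
    (hg0 : {ae surface_measure d, forall x, sphere x -> g 0%N x = 0})
    (hsigma : forward_euler_solution dt N g sigma) :
  (l2L2_norm N sigma <=
   (expR 1 * d%:R * 2 ^+ d.-1 * Gamma (d%:R / 2) * T `^ (d%:R / 2))%:E *
     l2L2_norm N g)%E.
Proof.
have T0 : 0 < T by exact: lt_le_trans hT.
have C0 : 0 < stability_constant (n := d) T := stability_constant_gt0 hd T0.
have mg j : (j <= N)%N -> measurable_fun setT (g j).
  by move=> /hg; rewrite inE => /andP[]; rewrite inE.
have gfin j : (j <= N)%N -> (energy (g j) < +oo)%E.
  move=> /hg; rewrite inE => /andP[_]; rewrite inE/= /finite_norm => gj.
  rewrite -Lnorm2_sqrE.
  have /fineK <- : Lnorm (surface_measure d) 2%:E (EFin \o g j) \is a fin_num.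
    by rewrite ge0_fin_numE ?Lnorm_ge0.
  by rewrite -EFin_expe ltry.
have := total_energy_le hd hT hdt hNdt mg hsigma gfin.
rewrite invrK /l2L2_norm => H.
under eq_bigr do rewrite Lnorm2_sqrE.
under [X in (_ <= _ * X `^ _)%E]eq_bigr do rewrite Lnorm2_sqrE.
have sum0 (f : nat -> vec R d -> R) : (0 <= \sum_(j < N.+1) energy (f j))%E.
  by apply: sume_ge0 => j _; exact: energy_ge0.
(* [H] compares squared norms; the square root is monotone on [0, +oo] and turns C^2 into C. *)
have := @gt0_ler_poweR R 2^-1; rewrite invr_ge0 ler0n => /(_ isT) mono.
apply: (le_trans (mono _ _ _ _ H)).
- by rewrite in_itv/= leey sum0.
- by rewrite in_itv/= leey mule_ge0// lee_fin sqr_ge0.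
rewrite poweRM ?sum0 ?lee_fin ?sqr_ge0// poweR_EFin powR12_sqrt ?sqr_ge0//.
by rewrite sqrtr_sqr gtr0_norm.
Qed.
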